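(* Let the quartic $X$ be a general member of the family $\mathcal{Z}$ and let $\ell=V(x_3,x_4)\subset X$, which is a line of the second kind. (a) $X$ is smooth and contains exactly $18$ lines $\ell'\ne\ell$ that meet $\ell$. (b) The quartic $X$ cannot be obtained from Segre's construction with respect to $\ell$; that is, $X$ is not given by any equation $S+\hat L_1\cdots\hat L_4=0$ in which the quartic $S$ is a union of a family of lines, each of which meets $\ell$, and the planes $\hat L_1,\dots,\hat L_4$ meet along $\ell$. (c) The surface $S_8$ defined by $(X,\ell)$ consists of two planes and an irreducible sextic.
   Context: $\mathbb{K}$ is an algebraically closed field of characteristic different from $2$ and $3$. The same symbol is used for a homogeneous polynomial and its zero set. Family $\mathcal{Z}$: quartics in $\mathbb{P}^3_{\mathbb{K}}$ given by the polynomials $$x_3x_1^3+x_4x_2^3+x_1x_2\,q(x_3,x_4)+g(x_3,x_4),$$ where $q,g\in\mathbb{K}[x_3,x_4]$ are homogeneous of degree $2$, resp. $4$. ''General'' means: for parameters $(q,g)$ in some nonempty Zariski-open subset of the parameter space. Let $X$ be a smooth quartic containing a line $\ell$. The linear system $|\mathcal{O}_X(1)-\ell|$ gives an elliptic fibration $\pi:X\to\mathbb{P}^1$ whose fibers are the plane cubics residual to $\ell$ in $X\cap H$, for planes $H\supset\ell$; $\ell$ is of the second kind iff it is contained in the (Zariski) closure of the set of inflection points of the smooth fibers of $\pi$. For $P\in\ell$, $F_P$ denotes the plane cubic with $X\cap T_PX=\ell+F_P$. The surface $S_8$ defined by $(X,\ell)$ is the union of all lines in $$\mathfrak{S}_\ell=\{\tilde\ell\subset\mathbb{P}^3\text{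 a line}:\ \exists P\in\ell\text{ with }\tilde\ell\subset T_PX\text{ and }i(\tilde\ell,F_P;P)\ge2\},$$ where $i(\tilde\ell,F_P;P)$ is the intersection multiplicity at $P$ of $\tilde\ell$ and the cubic $F_P$ inside the plane $T_PX$ (taken to be $\infty$ if $P\in\tilde\ell\subset F_P$); it is a hypersurface in $\mathbb{P}^3$. *)

(* Defs.v *)
From HB Require Import structures.
From mathcomp Require Import all_boot all_order all_algebra.
From mathcomp Require Export mpoly.
Set Implicit Arguments. Unset Strict Implicit. Unset Printing Implicit Defensive.
Import GRing.Theory.
Local Open Scope ring_scope.

(* A point of P^3 is a nonzero row vector of K^4 up to scaling; lines and      *)
(* planes of P^3 are the subspaces of K^4 of dimension 2 and 3. A surface is   *)
(* given by a homogeneous p : {mpoly K[4]}, evaluated at v as p.@[v 0]. The    *)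
(* coordinates x_1, ..., x_4 have indices 0, ..., 3.                           *)

Section ProjectiveSpace.
Variable K : fieldType.
Implicit Types (v w P : 'rV[K]_4) (p f c h S : {mpoly K[4]})
  (L M H : {vspace 'rV[K]_4}).

Definition is_line L : Prop := \dim L = 2%N.
Definition is_plane H : Prop := \dim H = 3%N.
Definition meets L M : Prop := (L :&: M)%VS <> 0%VS.

Definition vanishes_on p L : Prop := forall v, v \in L -> p.@[v 0] = 0.

Definition hyperplane (a : 'cV[K]_4) : {vspace 'rV[K]_4} :=
  lker (linfun (mulmxr a : 'rV[K]_4 -> 'rV[K]_1)).

Lemma mem_hyperplane a v : (v \in hyperplane a) = (v *m a == 0).
Proof. by rewrite memv_ker lfunE. Qed.

(* T_P V(p), when P is a smooth point of V(p); the whole space otherwise. *)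
Definition tangent_space p P : {vspace 'rV[K]_4} :=
  hyperplane (\col_i (p^`M(i)).@[P 0]).

(* Jacobian criterion for the subscheme V(p) of P(H): some derivative of p in *)
(* a direction of H is nonzero at each of its points.                         *)
Definition smooth_in H p : Prop :=
  forall v, v \in H -> v != 0 -> p.@[v 0] = 0 -> ~~ (H <= tangent_space p v)%VS.

Definition smooth_surface p : Prop := smooth_in fullv p.

(* p(P + T w), as a polynomial in T. *)
Definition restrict_line p P w : {poly K} :=
  mmap polyC (fun i => (P 0 i)%:P + w 0 i *: 'X) p.

(* For k >= 1 and P a point of P^3: i(L, V(p); P) >= k, the multiplicity being *)
(* the order of vanishing at P of the restriction of p to L. It is infinite    *)
(* when L is contained in V(p), since 'X^k divides 0. Directions w             *)
(* proportional to P only impose p(P) = 0.                                     *)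
Definition intersection_ge L p P (k : nat) : Prop :=
  P \in L /\ forall w, w \in L -> 'X^k %| restrict_line p P w.

(* The plane section of the quartic V(f) by H is L + V(c): on H, f is the      *)
(* product of c and an equation of L. The cubic c matters only on H.           *)
Definition residual_cubic f L H c : Prop :=
  c \is 3.-homog /\
  exists h, [/\ h \is 1.-homog,
                vanishes_on h L,
                ~ vanishes_on h H
              & forall v, v \in H -> f.@[v 0] = h.@[v 0] * c.@[v 0]].

Definition inflection_point H c P : Prop :=
  [/\ P \in H, P != 0
    & exists L, [/\ is_line L, (L <= H)%VS & intersection_ge L c P 3]].

Definition smooth_fiber_inflection f L P : Prop :=
  exists H c, [/\ is_plane H, (L <= H)%VS, residual_cubic f L H c,
                  smooth_in H c & inflection_point H c P].

(* Zariski closure in P^3 of a set of points. *)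
Definition proj_closure (A : 'rV[K]_4 -> Prop) v : Prop :=
  forall d p, p \is d.-homog -> (forall u, A u -> p.@[u 0] = 0) -> p.@[v 0] = 0.

Definition second_kind f L : Prop :=
  forall v, v \in L -> v != 0 -> proj_closure (smooth_fiber_inflection f L) v.

Definition union_of_lines_meeting S L : Prop :=
  exists F : {vspace 'rV[K]_4} -> Prop,
    (forall M, F M -> is_line M /\ meets M L) /\
    (forall v, v != 0 -> (S.@[v 0] = 0 <-> exists2 M, F M & v \in M)).

(* V(f) is also V(a f) for every nonzero scalar a. *)
Definition segre_construction f L : Prop :=
  exists (S : {mpoly K[4]}) (l : 'I_4 -> {mpoly K[4]}) (a : K),
    [/\ a != 0,
        a *: f = S + \prod_i l i,
        [/\ S \is 4.-homog, S != 0 & union_of_lines_meeting S L],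
        forall i, l i \is 1.-homog /\ l i != 0
      & forall v, v \in L <-> (forall i, (l i).@[v 0] = 0)].

(* The set of lines denoted S_l (fraktur) in the construction of S_8. *)
Definition S8_line f L M : Prop :=
  is_line M /\
  exists P c, [/\ P \in L, P != 0, (M <= tangent_space f P)%VS,
                  residual_cubic f L (tangent_space f P) c
                & intersection_ge M c P 2].

Definition S8 f L v : Prop := exists2 M, S8_line f L M & v \in M.

End ProjectiveSpace.

Definition irreducible_elt (R : idomainType) (p : R) : Prop :=
  [/\ p != 0, p \isn't a GRing.unit
    & forall r s, p = r * s -> r \is a GRing.unit \/ s \is a GRing.unit].

Definition zariski_open (K : fieldType) n (U : 'rV[K]_n -> Prop) : Prop :=
  exists I : {mpoly K[n]} -> Prop,
    forall v, U v <-> exists2 p, I p & p.@[v 0] != 0.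

Section FamilyZ.
Variable K : fieldType.

Definition x1 : {mpoly K[4]} := 'X_(inord 0%N).
Definition x2 : {mpoly K[4]} := 'X_(inord 1%N).
Definition x3 : {mpoly K[4]} := 'X_(inord 2%N).
Definition x4 : {mpoly K[4]} := 'X_(inord 3%N).

(* The form of degree d in x_3, x_4 with coefficient vector a. *)
Definition binary_form d (a : 'rV[K]_d.+1) : {mpoly K[4]} :=
  \sum_(i < d.+1) a 0 i *: (x3 ^+ (d - i) * x4 ^+ i).

Definition quarticZ (q : 'rV[K]_3) (g : 'rV[K]_5) : {mpoly K[4]} :=
  x3 * x1 ^+ 3 + x4 * x2 ^+ 3 + x1 * x2 * binary_form q + binary_form g.

(* The line V(x_3, x_4). *)
Definition ell : {vspace 'rV[K]_4} :=
  (hyperplane (delta_mx (inord 2%N) 0%R) :&: hyperplane (delta_mx (inord 3%N) 0%R))%VS.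

Lemma mem_ell v : (v \in ell) = (v 0 (inord 2%N) == 0) && (v 0 (inord 3%N) == 0).
Proof.
have E i : (v *m delta_mx i 0 == 0 :> 'rV[K]_1) = (v 0 i == 0).
  rewrite -colE; apply/eqP/eqP=> [/rowP/(_ 0)|vi]; first by rewrite !mxE.
  by apply/rowP=> j; rewrite !mxE vi.
by rewrite memv_cap !mem_hyperplane !E.
Qed.

End FamilyZ.

Arguments ell {K}.

(* Main.v *)
Require Import Defs.
From mathcomp Require Import all_boot all_order all_algebra separable.
From mathcomp Require Import ring.
Set Implicit Arguments. Unset Strict Implicit. Unset Printing Implicit Defensive.
Import GRing.Theory.
Local Open Scope ring_scope.

(** The planes through [ell] are [(x_3 : x_4) = (s : t)]. On such a plane, with
    [x_3 = s z] and [x_4 = t z], the quartic is [z] times the cubic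
    [s x_1^3 + t x_2^3 + q(s,t) x_1 x_2 z + g(s,t) z^3], and [T_P X] for
    [P = (a : b : 0 : 0)] is the plane [a^3 x_3 + b^3 x_4 = 0]. For [a b <> 0]
    the point can be scaled to [(l : 1 : 0 : 0)], whose plane is
    [(1 : - l^3)]; everything becomes explicit in the parameter [l].

    The tangent to the cubic at [P] is
    [3 l^2 x_1 - 3 l^3 x_2 + l q(1,-l^3) z = 0], and substituting it in the cubic
    leaves [z^3 (g - (q / (3 l))^3)]. So [P] is an inflection point of its fibre
    whenever that fibre is smooth (the line is of the second kind), and the tangent
    lies on [X] exactly when [q^3 - 27 l^3 g = 0] at [(1, -l^3)]. This is a
    polynomial of degree 18 in [l]; when it is separable it yields the 18 lines
    ([eighteen_lines]).

    A singular point of [X] with [x_1 x_2 <> 0] would give a double root of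
    [q^3 + 27 x_3 x_4 g], and one with [x_1 x_2 = 0] a double root of [g]; for
    general [(q, g)] neither exists ([smooth_quarticZ]).

    For Segre's construction, subtracting a product of four planes through [ell]
    only changes [g]. A line meeting [ell] on the new quartic again forces
    [q^3 + 27 s t g' = 0] on its plane, whereas the quartic has points on the planes
    where this fails ([not_segre]).

    If [a b = 0], the cubic [F_P] is singular at [P], so all lines of [T_P X]
    through [P] belong to the family: these are the planes [x_3 = 0], [x_4 = 0]. In
    the other cases, with [l^3 = - x_4 / x_3], the lines sweep out
    [3 l x_1 x_3 + 3 l^-1 x_2 x_4 + q = 0], and the product over the three cube
    roots is the sextic of [sextic]. On the plane [x_2 = 0] it becomes
    [q^3 - 27 x_3^2 x_4 x_1^3], irreducible since [x_3^2 x_4] is not a cube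
    ([irreducible_sextic]).

    The conditions on [(q, g)] amount to the nonvanishing of one polynomial in the
    coefficients, a product of coefficients and resultants ([general_polyP]), and
    an explicit pair satisfies them in every characteristic other than 2 and 3
    ([general_witness]). *)

(** * Coordinates, binary forms and restriction to lines *)

Lemma sum_inord n (V : nmodType) (F : 'I_n.+1 -> V) :
  \sum_i F i = \sum_(0 <= k < n.+1) F (inord k).
Proof. by rewrite big_mkord; apply: eq_bigr => i _; rewrite inord_val. Qed.

Definition pt (K : nmodType) (a b c d : K) : 'rV[K]_4 :=
  \row_i nth 0 [:: a; b; c; d] i.

Lemma ptE (K : nmodType) (a b c d : K) :
  (((pt a b c d) 0 (inord 0) = a) * ((pt a b c d) 0 (inord 1) = b)) *
  (((pt a b c d) 0 (inord 2) = c) * ((pt a b c d) 0 (inord 3) = d)).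
Proof. by rewrite !mxE !inordK. Qed.

Lemma ord4P (P : 'I_4 -> Prop) :
  P (inord 0) -> P (inord 1) -> P (inord 2) -> P (inord 3) -> forall i, P i.
Proof.
move=> P0 P1 P2 P3 i; rewrite -(inord_val i).
by case: i => [[|[|[|[|//]]]]] /=.
Qed.

Lemma rV4P (K : nmodType) (v w : 'rV[K]_4) :
  v 0 (inord 0) = w 0 (inord 0) -> v 0 (inord 1) = w 0 (inord 1) ->
  v 0 (inord 2) = w 0 (inord 2) -> v 0 (inord 3) = w 0 (inord 3) -> v = w.
Proof. by move=> *; apply/rowP; apply: ord4P. Qed.

Lemma rV4_eta (K : nmodType) (v : 'rV[K]_4) :
  v = pt (v 0 (inord 0)) (v 0 (inord 1)) (v 0 (inord 2)) (v 0 (inord 3)).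
Proof. by apply: rV4P; rewrite ptE. Qed.

Lemma pt_eq0 (K : nmodType) (a b c d : K) :
  (pt a b c d == 0) = [&& a == 0, b == 0, c == 0 & d == 0].
Proof.
apply/eqP/and4P => [E | [/eqP-> /eqP-> /eqP-> /eqP->]].
  split; apply/eqP; have H := ptE a b c d; rewrite E !mxE in H.
  - by rewrite -H.1.1.
  - by rewrite -H.1.2.
  - by rewrite -H.2.1.
  - by rewrite -H.2.2.
by apply: rV4P; rewrite ptE mxE.
Qed.

Lemma ptDZ (K : comNzRingType) (a b c d a' b' c' d' T : K) :
  pt a b c d + T *: pt a' b' c' d'
  = pt (a + T * a') (b + T * b') (c + T * c') (d + T * d').
Proof. by apply: rV4P; rewrite !(mxE, inordK). Qed.

Definition form2 (R : comNzRingType) (q0 q1 q2 s t : R) : R :=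
  q0 * s ^+ 2 + q1 * (s * t) + q2 * t ^+ 2.
Definition form4 (R : comNzRingType) (g0 g1 g2 g3 g4 s t : R) : R :=
  g0 * s ^+ 4 + g1 * (s ^+ 3 * t) + g2 * (s ^+ 2 * t ^+ 2)
  + g3 * (s * t ^+ 3) + g4 * t ^+ 4.

Section Coord.
Variables (K : fieldType) (S : comNzRingType) (phi : {rmorphism K -> S}).
Variable (h : 'I_4 -> S).
Implicit Types (q : 'rV[K]_3) (g : 'rV[K]_5).

Lemma mmapXU i : mmap phi h 'X_i = h i.
Proof. by rewrite mmapX mmap1U. Qed.

Lemma mmap_form2 q : mmap phi h (binary_form q) =
  form2 (phi (q 0 (inord 0))) (phi (q 0 (inord 1))) (phi (q 0 (inord 2)))
        (h (inord 2)) (h (inord 3)).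
Proof.
rewrite /binary_form sum_inord unlock /= !inordK // addr0 /x3 /x4.
by rewrite !rmorphD /= !mmapZ !(rmorphXn, rmorphM) /= !mmapXU /form2; ring.
Qed.

Lemma mmap_form4 g : mmap phi h (binary_form g) =
  form4 (phi (g 0 (inord 0))) (phi (g 0 (inord 1))) (phi (g 0 (inord 2)))
        (phi (g 0 (inord 3))) (phi (g 0 (inord 4))) (h (inord 2)) (h (inord 3)).
Proof.
rewrite /binary_form sum_inord unlock /= !inordK // addr0 /x3 /x4.
by rewrite !rmorphD /= !mmapZ !(rmorphXn, rmorphM) /= !mmapXU /form4; ring.
Qed.

Lemma mmap_quarticZ q g : mmap phi h (quarticZ q g) =
  h (inord 2) * h (inord 0) ^+ 3 + h (inord 3) * h (inord 1) ^+ 3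
  + h (inord 0) * h (inord 1) * mmap phi h (binary_form q)
  + mmap phi h (binary_form g).
Proof.
by rewrite /quarticZ /x1 /x2 /x3 /x4 !rmorphD /= !(rmorphXn, rmorphM) /= !mmapXU.
Qed.

End Coord.

Section Values.
Variable K : fieldType.
Implicit Types (q : 'rV[K]_3) (g : 'rV[K]_5) (v w P : 'rV[K]_4).

Definition qval q (s t : K) : K :=
  form2 (q 0 (inord 0)) (q 0 (inord 1)) (q 0 (inord 2)) s t.
Definition gval g (s t : K) : K :=
  form4 (g 0 (inord 0)) (g 0 (inord 1)) (g 0 (inord 2)) (g 0 (inord 3))
        (g 0 (inord 4)) s t.

Lemma qvalZ q z s t : qval q (z * s) (z * t) = z ^+ 2 * qval q s t.
Proof. by rewrite /qval /form2; ring. Qed.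

Lemma gvalZ g z s t : gval g (z * s) (z * t) = z ^+ 4 * gval g s t.
Proof. by rewrite /gval /form4; ring. Qed.

Definition fval q g (a b c d : K) : K :=
  c * a ^+ 3 + d * b ^+ 3 + a * b * qval q c d + gval g c d.

Lemma meval_form2 q v :
  (binary_form q).@[v 0] = qval q (v 0 (inord 2)) (v 0 (inord 3)).
Proof. exact: mmap_form2. Qed.

Lemma meval_form4 g v :
  (binary_form g).@[v 0] = gval g (v 0 (inord 2)) (v 0 (inord 3)).
Proof. exact: mmap_form4. Qed.

Lemma meval_quarticZ q g v : (quarticZ q g).@[v 0] =
  fval q g (v 0 (inord 0)) (v 0 (inord 1)) (v 0 (inord 2)) (v 0 (inord 3)).
Proof.
by rewrite /fval -meval_form2 -meval_form4; apply: mmap_quarticZ.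
Qed.

Lemma horner_restrict_line (p : {mpoly K[4]}) P w T :
  (restrict_line p P w).[T] = p.@[(P + T *: w) 0].
Proof.
rewrite /restrict_line /mmap horner_sum mevalE; apply: eq_bigr => m _.
rewrite hornerM hornerC /mmap1 horner_prod; congr (_ * _).
by apply: eq_bigr => i _; rewrite horner_exp hornerD hornerC hornerZ hornerX !mxE mulrC.
Qed.

Lemma mmap_polyC_horner n (p : {mpoly K[n]}) (c : 'I_n -> {poly K}) t :
  (mmap polyC c p).[t] = p.@[fun i => (c i).[t]].
Proof.
rewrite /mmap horner_sum mevalE; apply: eq_bigr => m _.
rewrite hornerM hornerC /mmap1 horner_prod; congr (_ * _).
by apply: eq_bigr => i _; rewrite horner_exp.
Qed.

(** Turns orders of vanishing along a line into vanishing of Taylor coefficients. *)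
Lemma dvdp_Xn_coef n (p : {poly K}) :
  reflect (forall i, (i < n)%N -> p`_i = 0) ('X^n %| p).
Proof.
apply: (iffP idP) => [/dvdpP[r ->] i lt_in|p0]; first by rewrite coefMXn lt_in.
rewrite -(poly_take_drop n p).
suff -> : take_poly n p = 0 by rewrite add0r dvdp_mulIr.
by apply/polyP => i; rewrite coef_take_poly coef0; case: ifP => // /p0.
Qed.

Lemma mem_tangent_space (p : {mpoly K[4]}) P w :
  (w \in tangent_space p P) = (\sum_i w 0 i * (p^`M(i)).@[P 0] == 0).
Proof.
rewrite mem_hyperplane; apply/eqP/eqP => [/rowP/(_ 0)|E].
  by rewrite !mxE => E; rewrite -[RHS]E; apply: eq_bigr => i _; rewrite !mxE.
by apply/rowP => j; rewrite !mxE -[RHS]E; apply: eq_bigr => i _; rewrite !mxE.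
Qed.

Lemma mderivXU n (i j : 'I_n) : ('X_j : {mpoly K[n]})^`M(i) = (i == j)%:R.
Proof.
rewrite mderivX mnm1E eq_sym; case: eqP => [->|_]; last by rewrite scale0r.
by rewrite scale1r -[X in (X - _)%MM]add0m addmK mpolyX0.
Qed.

Lemma mderivXUn n (i j : 'I_n) k :
  ('X_j ^+ k : {mpoly K[n]})^`M(i) = (i == j)%:R *: ('X_j ^+ k.-1 *+ k).
Proof.
case: eqP => [<-|]; last first.
  elim: k => [|k IH] ne; first by rewrite expr0 mulr0n scaler0 -mpolyC1 mderivC.
  rewrite exprS mderivM IH // mderivXU scale0r mulr0 scale0r addr0.
  by case: eqP ne => // _ _; rewrite mul0r.
rewrite scale1r; elim: k => [|[|k] IH]; first by rewrite expr0 mulr0n -mpolyC1 mderivC.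
  by rewrite expr1 expr0 mulr1n mderivXU eqxx.
by rewrite exprS mderivM IH /= mderivXU eqxx mulrSr exprS; ring.
Qed.

Lemma ord4_eq i j : (i < 4)%N -> (j < 4)%N ->
  ((inord i : 'I_4) == inord j) = (i == j).
Proof. by move=> lt_i lt_j; rewrite -val_eqE /= !inordK. Qed.

Lemma binary_form2E q : binary_form q =
  q 0 (inord 0) *: x3 K ^+ 2 + q 0 (inord 1) *: (x3 K * x4 K)
  + q 0 (inord 2) *: x4 K ^+ 2.
Proof.
rewrite /binary_form sum_inord unlock /= !inordK //.
rewrite addr0 -!addrA; congr (_ *: _ + (_ *: _ + _ *: _)).
- exact: mulr1.
- exact: mul1r.
Qed.

Lemma binary_form4E g : binary_form g =
  g 0 (inord 0) *: x3 K ^+ 4 + g 0 (inord 1) *: (x3 K ^+ 3 * x4 K)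
  + g 0 (inord 2) *: (x3 K ^+ 2 * x4 K ^+ 2) + g 0 (inord 3) *: (x3 K * x4 K ^+ 3)
  + g 0 (inord 4) *: x4 K ^+ 4.
Proof.
rewrite /binary_form sum_inord unlock /= !inordK //.
rewrite addr0 -!addrA.
congr (_ *: _ + (_ *: _ + (_ *: _ + (_ *: _ + _ *: _)))).
- exact: mulr1.
- exact: mul1r.
Qed.

(** Evaluation and differentiation go through these monomials, which are opaque
    once their rules are known: rewriting with the product rule directly would
    unfold the powers. *)
Definition mon (i j k l : nat) : {mpoly K[4]} :=
  'X_(inord 0) ^+ i * 'X_(inord 1) ^+ j * 'X_(inord 2) ^+ k * 'X_(inord 3) ^+ l.

Lemma meval_mon i j k l v : (mon i j k l).@[v 0] =
  v 0 (inord 0) ^+ i * v 0 (inord 1) ^+ j * v 0 (inord 2) ^+ k * v 0 (inord 3) ^+ l.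
Proof. by rewrite /mon !mevalM !rmorphXn /= !mevalXU. Qed.

Lemma mderiv_mon i j k l :
  (((mon i j k l)^`M(inord 0) = i%:R *: mon i.-1 j k l) *
   ((mon i j k l)^`M(inord 1) = j%:R *: mon i j.-1 k l)) *
  (((mon i j k l)^`M(inord 2) = k%:R *: mon i j k.-1 l) *
   ((mon i j k l)^`M(inord 3) = l%:R *: mon i j k l.-1)).
Proof.
split; split.
all: rewrite /mon 3!mderivM !mderivXUn !ord4_eq //=.
all: rewrite !(scale0r, scale1r, mulr0, mul0r, addr0, add0r) ?scaler_nat.
- by rewrite -!mulrnAl.
- by rewrite mulrnAr -!mulrnAl.
- by rewrite mulrnAr -!mulrnAl.
- by rewrite mulrnAr.
Qed.

Lemma dhomog_mon i j k l : mon i j k l \is (i + j + k + l).-homog.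
Proof.
have h a n : ('X_a : {mpoly K[4]}) ^+ n \is n.-homog.
  by rewrite -[n in n.-homog]mul1n; apply: dhomogMn; rewrite dhomogX; apply/eqP/mdeg1.
by do 3!apply: dhomogM => //.
Qed.

Lemma quarticZ_mon q g : quarticZ q g =
  mon 3 0 1 0 + mon 0 3 0 1
  + (q 0 (inord 0) *: mon 1 1 2 0 + q 0 (inord 1) *: mon 1 1 1 1
     + q 0 (inord 2) *: mon 1 1 0 2)
  + (g 0 (inord 0) *: mon 0 0 4 0 + g 0 (inord 1) *: mon 0 0 3 1
     + g 0 (inord 2) *: mon 0 0 2 2 + g 0 (inord 3) *: mon 0 0 1 3
     + g 0 (inord 4) *: mon 0 0 0 4).
Proof.
rewrite /quarticZ binary_form2E binary_form4E /mon /x1 /x2 /x3 /x4.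
rewrite -!mul_mpolyC; ring.
Qed.
Opaque mon.

Lemma mderiv_quarticZ q g v
   (a := v 0 (inord 0)) (b := v 0 (inord 1)) (c := v 0 (inord 2))
   (d := v 0 (inord 3)) :
  [/\ ((quarticZ q g)^`M(inord 0)).@[v 0] = 3 * c * a ^+ 2 + b * qval q c d,
      ((quarticZ q g)^`M(inord 1)).@[v 0] = 3 * d * b ^+ 2 + a * qval q c d,
      ((quarticZ q g)^`M(inord 2)).@[v 0] = a ^+ 3
        + a * b * (2 * q 0 (inord 0) * c + q 0 (inord 1) * d)
        + (4 * g 0 (inord 0) * c ^+ 3 + 3 * g 0 (inord 1) * c ^+ 2 * d
          + 2 * g 0 (inord 2) * c * d ^+ 2 + g 0 (inord 3) * d ^+ 3)
    & ((quarticZ q g)^`M(inord 3)).@[v 0] = b ^+ 3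
        + a * b * (q 0 (inord 1) * c + 2 * q 0 (inord 2) * d)
        + (g 0 (inord 1) * c ^+ 3 + 2 * g 0 (inord 2) * c ^+ 2 * d
          + 3 * g 0 (inord 3) * c * d ^+ 2 + 4 * g 0 (inord 4) * d ^+ 3)].
Proof.
rewrite quarticZ_mon.
split; rewrite !(mderivD, mderivZ, mderiv_mon) !(mevalD, mevalZ, meval_mon);
rewrite -/a -/b -/c -/d /qval /form2 /=; ring.
Qed.

End Values.

(** * Lines of P^3 and residual cubics *)

Lemma poly_eq_fun (K : closedFieldType) (p r : {poly K}) :
  (forall t, p.[t] = r.[t]) -> p = r.
Proof.
move=> E; apply/eqP; rewrite -subr_eq0; apply/negPn/negP => /closed_nonrootP[t].
by rewrite /root hornerD hornerN E subrr eqxx.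
Qed.

Lemma cube_root (K : closedFieldType) (x : K) : exists l, l ^+ 3 = x.
Proof.
have [l] := solve_monicpoly (n := 3%N) (fun i => if i == 0%N then x else 0) isT.
by rewrite !big_ord_recl big_ord0 /= !mul0r !addr0 mulr1 => E; exists l.
Qed.

Section Lines.
Variable K : fieldType.
Implicit Types (P v w : 'rV[K]_4) (M : {vspace 'rV[K]_4}).

Definition span2 P v : {vspace 'rV[K]_4} := (<[P]> + <[v]>)%VS.

Lemma mem_span2P P v w :
  reflect (exists x y, w = x *: P + y *: v) (w \in span2 P v).
Proof.
apply: (iffP memv_addP) => [[_ /vlineP[x ->] [_ /vlineP[y ->] ->]]|[x [y ->]]].
  by exists x, y.
by exists (x *: P); rewrite ?memvZ ?memv_line //; exists (y *: v);
  rewrite ?memvZ ?memv_line.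
Qed.

Lemma span2_l P v : P \in span2 P v.
Proof. by apply/mem_span2P; exists 1, 0; rewrite scale1r scale0r addr0. Qed.

Lemma span2_r P v : v \in span2 P v.
Proof. by apply/mem_span2P; exists 0, 1; rewrite scale1r scale0r add0r. Qed.

Lemma span2_sub P v M : P \in M -> v \in M -> (span2 P v <= M)%VS.
Proof. by move=> PM vM; rewrite subv_add -!memvE PM vM. Qed.

Lemma is_line_span2 P v : P != 0 -> v \notin <[P]>%VS -> is_line (span2 P v).
Proof.
move=> P0 vP; rewrite /is_line /span2 dimv_disjoint_sum ?dim_vline ?P0.
  by case: eqP vP => // ->; rewrite mem0v.
apply/eqP; rewrite -subv0; apply/subvP => w; rewrite memv_cap memv0.
move=> /andP[wP /vlineP[y wE]]; move: wP; rewrite {}wE.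
by rewrite rpredZeq (negPf vP) orbF => /eqP->; rewrite scale0r.
Qed.

Lemma mem_pt_ell (a b c d : K) : (pt a b c d \in ell) = (c == 0) && (d == 0).
Proof. by rewrite mem_ell !ptE. Qed.

Lemma ell_pt v : v \in ell -> v = pt (v 0 (inord 0)) (v 0 (inord 1)) 0 0.
Proof. by rewrite mem_ell => /andP[/eqP v2 /eqP v3]; rewrite {1}[v]rV4_eta v2 v3. Qed.

Lemma not_ell_line (a b : K) v : v \notin ell -> v \notin <[pt a b 0 0]>%VS.
Proof.
apply: contra => /vlineP[x ->]; rewrite memvZ // mem_ell !ptE eqxx //.
Qed.

Lemma sum_ord4 (V : nmodType) (F : 'I_4 -> V) :
  \sum_i F i = F (inord 0) + F (inord 1) + F (inord 2) + F (inord 3).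
Proof. by rewrite sum_inord unlock /= addr0 !addrA. Qed.

Lemma mem_tangent_ell q g (a b : K) w :
  (w \in tangent_space (quarticZ q g) (pt a b 0 0)) =
  (a ^+ 3 * w 0 (inord 2) + b ^+ 3 * w 0 (inord 3) == 0).
Proof.
rewrite mem_tangent_space sum_ord4.
have [-> -> -> ->] := mderiv_quarticZ q g (pt a b 0 0).
by rewrite !ptE /qval /form2; congr (_ == _); ring.
Qed.

(** The residual cubic on the plane [(x_3 : x_4) = (s : t)], for [k = q(s,t)] and
    [m = g(s,t)]. The pair [(i, j)] is [(1, 0)] or [(0, 1)] and selects
    [z = x_3] (when [s = 1]) or [z = x_4] (when [t = 1]) as third coordinate. *)
Definition cubicZ (i j : nat) (s t k m : K) : {mpoly K[4]} :=
  s *: mon K 3 0 0 0 + t *: mon K 0 3 0 0 + k *: mon K 1 1 i j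
  + m *: mon K 0 0 (3 * i) (3 * j).

Lemma dhomog_cubicZ i j s t k m : (i + j = 1)%N -> cubicZ i j s t k m \is 3.-homog.
Proof.
move=> ij; do 3?apply: dhomogD; apply: dhomogZ.
- exact: (dhomog_mon _ 3 0 0 0).
- exact: (dhomog_mon _ 0 3 0 0).
- by have := dhomog_mon K 1 1 i j; rewrite -addnA ij.
- by have := dhomog_mon K 0 0 (3 * i) (3 * j); rewrite !add0n -mulnDr ij.
Qed.

Lemma meval_cubicZ i j s t k m w (z := w 0 (inord 2) ^+ i * w 0 (inord 3) ^+ j)
   (a := w 0 (inord 0)) (b := w 0 (inord 1)) :
  (cubicZ i j s t k m).@[w 0] =
  s * a ^+ 3 + t * b ^+ 3 + k * (a * b * z) + m * z ^+ 3.
Proof.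
rewrite /cubicZ !mevalD !mevalZ !meval_mon -/a -/b.
have -> : z ^+ 3 = w 0 (inord 2) ^+ (3 * i) * w 0 (inord 3) ^+ (3 * j).
  by rewrite /z exprMn -!exprM ![(_ * 3)%N]mulnC.
by rewrite !(expr0, mulr1, mul1r, expr1) /z !mulrA.
Qed.

(** The equation of [ell] in the plane is [z]; homogeneity of [q] and [g] extracts
    the factor [z] from the restriction of the quartic. *)
Lemma residual_cubicZ q g i j s t (H : {vspace 'rV[K]_4})
   (z := fun w : 'rV[K]_4 => w 0 (inord 2) ^+ i * w 0 (inord 3) ^+ j) :
  (i + j = 1)%N ->
  (forall w, w \in H -> w 0 (inord 2) = s * z w /\ w 0 (inord 3) = t * z w) ->
  (exists2 w, w \in H & z w != 0) ->
  residual_cubic (quarticZ q g) ell H (cubicZ i j s t (qval q s t) (gval g s t)).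
Proof.
move=> ij st [w0 w0H z0]; split; first exact: dhomog_cubicZ.
have evz w : (mon K 0 0 i j).@[w 0] = z w by rewrite meval_mon /z; ring.
exists (mon K 0 0 i j); split.
- by have := dhomog_mon K 0 0 i j; rewrite !add0n ij.
- move=> v; rewrite mem_ell => /andP[/eqP v2 /eqP v3]; rewrite evz /z v2 v3 -exprD ij.
  exact: expr0n.
- by move/(_ _ w0H)/eqP; rewrite evz (negPf z0).
move=> v /st[E2 E3]; rewrite evz meval_quarticZ meval_cubicZ -/(z v).
rewrite /fval {1 2 3}E2 {1 2 3}E3 ![_ * z v]mulrC qvalZ gvalZ; ring.
Qed.

End Lines.

Section RestrictEll.
Variable K : closedFieldType.
Implicit Types (q : 'rV[K]_3) (g : 'rV[K]_5) (v w : 'rV[K]_4).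

(** Expansion of the quartic along the line joining [(a, b, 0, 0)] to
    [(c, d, s, t)]; all later arguments read off these coefficients. *)
Lemma fval_ell q g (a b T c d s t : K) :
  fval q g (a + T * c) (b + T * d) (T * s) (T * t) =
  T * (a ^+ 3 * s + b ^+ 3 * t)
  + T ^+ 2 * (3 * a ^+ 2 * c * s + 3 * b ^+ 2 * d * t + a * b * qval q s t)
  + T ^+ 3 * (3 * a * c ^+ 2 * s + 3 * b * d ^+ 2 * t
              + (a * d + b * c) * qval q s t)
  + T ^+ 4 * fval q g c d s t.
Proof. rewrite /fval qvalZ gvalZ; ring. Qed.

Definition ell_coefs q g (a b : K) w : seq K :=
  let c := w 0 (inord 0) in let d := w 0 (inord 1) in
  let s := w 0 (inord 2) in let t := w 0 (inord 3) in
  [:: 0; a ^+ 3 * s + b ^+ 3 * t;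
      3 * a ^+ 2 * c * s + 3 * b ^+ 2 * d * t + a * b * qval q s t;
      3 * a * c ^+ 2 * s + 3 * b * d ^+ 2 * t + (a * d + b * c) * qval q s t;
      fval q g c d s t].

Lemma restrict_quarticZ q g a b w :
  restrict_line (quarticZ q g) (pt a b 0 0) w = Poly (ell_coefs q g a b w).
Proof.
apply: poly_eq_fun => T; rewrite horner_restrict_line meval_quarticZ.
rewrite {1 2 3 4}[w]rV4_eta ptDZ !ptE !add0r fval_ell horner_Poly /=; ring.
Qed.

End RestrictEll.

(** * The binary forms that locate the special fibres *)

(** [g(1, t)], which vanishes at the planes whose residual cubic is singular at the
    point [x_1 = x_2 = 0]. *)
Definition node_poly (R : comNzRingType) (g0 g1 g2 g3 g4 : R) : {poly R} :=
  form4 g0%:P g1%:P g2%:P g3%:P g4%:P 1 'X.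
(** [(q^3 + 27 x_3 x_4 g)(1, t)], which vanishes at the planes whose residual
    cubic is a triangle. The coefficients are arguments because the polynomial is also
      needed
    over the ring of polynomials in the coefficients of [q] and [g]. *)
Definition triangle_poly (R : comNzRingType) (q0 q1 q2 g0 g1 g2 g3 g4 : R) : {poly R} :=
  form2 q0%:P q1%:P q2%:P 1 'X ^+ 3 + 27 * 'X * node_poly g0 g1 g2 g3 g4.
(** Its roots [l] are to be the points [(l : 1 : 0 : 0)] of [ell] lying on another
    line of the quartic; the tangent plane there is [(1 : - l^3)]. *)
Definition line_poly (R : comNzRingType) (q0 q1 q2 g0 g1 g2 g3 g4 : R) : {poly R} :=
  triangle_poly q0 q1 q2 g0 g1 g2 g3 g4 \Po (- 'X^3).

Section Sizes.
Variable R : idomainType.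
Variables q0 q1 q2 g0 g1 g2 g3 g4 : R.

Lemma node_polyE : node_poly g0 g1 g2 g3 g4 = Poly [:: g0; g1; g2; g3; g4].
Proof.
rewrite /node_poly /form4 /= !cons_poly_def; ring.
Qed.

Lemma size_node_poly : g4 != 0 -> size (node_poly g0 g1 g2 g3 g4) = 5.
Proof. by move=> g40; rewrite node_polyE (@PolyK _ 0). Qed.

Lemma triangle_polyE :
  triangle_poly q0 q1 q2 g0 g1 g2 g3 g4 =
  Poly [:: q0 ^+ 3;
    3 * q0 ^+ 2 * q1 + 27 * g0;
    3 * q0 ^+ 2 * q2 + 3 * q0 * q1 ^+ 2 + 27 * g1;
    6 * q0 * q1 * q2 + q1 ^+ 3 + 27 * g2;
    3 * q0 * q2 ^+ 2 + 3 * q1 ^+ 2 * q2 + 27 * g3;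
    3 * q1 * q2 ^+ 2 + 27 * g4; q2 ^+ 3].
Proof.
rewrite /triangle_poly /node_poly /form2 /form4 /= !cons_poly_def; ring.
Qed.

Lemma size_line_poly :
  q2 != 0 -> size (line_poly q0 q1 q2 g0 g1 g2 g3 g4) = 19.
Proof.
move=> q20; have sz : size (triangle_poly q0 q1 q2 g0 g1 g2 g3 g4) = 7.
  by rewrite triangle_polyE (@PolyK _ 0) //= expf_neq0.
have := size_comp_poly (triangle_poly q0 q1 q2 g0 g1 g2 g3 g4) (- 'X^3).
by rewrite -/(line_poly _ _ _ _ _ _ _ _) sz size_polyN size_polyXn;
  case: size => //= n [->].
Qed.

Lemma horner_node_poly t :
  (node_poly g0 g1 g2 g3 g4).[t] = form4 g0 g1 g2 g3 g4 1 t.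
Proof. rewrite node_polyE horner_Poly /= /form4; ring. Qed.

Lemma horner_triangle_poly t :
  (triangle_poly q0 q1 q2 g0 g1 g2 g3 g4).[t] =
  form2 q0 q1 q2 1 t ^+ 3 + 27 * t * form4 g0 g1 g2 g3 g4 1 t.
Proof. rewrite triangle_polyE horner_Poly /= /form4 /form2; ring. Qed.

Lemma horner_line_poly l :
  (line_poly q0 q1 q2 g0 g1 g2 g3 g4).[l] =
  form2 q0 q1 q2 1 (- l ^+ 3) ^+ 3 - 27 * l ^+ 3 * form4 g0 g1 g2 g3 g4 1 (- l ^+ 3).
Proof.
rewrite /line_poly horner_comp hornerN hornerXn horner_triangle_poly; ring.
Qed.

Lemma horner_deriv_node_poly t :
  (node_poly g0 g1 g2 g3 g4)^`().[t] =
  g1 + 2 * g2 * t + 3 * g3 * t ^+ 2 + 4 * g4 * t ^+ 3.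
Proof.
rewrite /node_poly /form4 expr1n !(derivE, hornerE, mul1r) /=; ring.
Qed.

Lemma horner_deriv_triangle_poly t :
  (triangle_poly q0 q1 q2 g0 g1 g2 g3 g4)^`().[t] =
  3 * form2 q0 q1 q2 1 t ^+ 2 * (q1 + 2 * q2 * t)
  + 27 * form4 g0 g1 g2 g3 g4 1 t
  + 27 * t * (g1 + 2 * g2 * t + 3 * g3 * t ^+ 2 + 4 * g4 * t ^+ 3).
Proof.
rewrite triangle_polyE /= !cons_poly_def !(derivE, hornerE) /= /form2 /form4; ring.
Qed.

Lemma horner_deriv_line_poly l :
  (line_poly q0 q1 q2 g0 g1 g2 g3 g4)^`().[l] =
  - 3 * l ^+ 2 * (triangle_poly q0 q1 q2 g0 g1 g2 g3 g4)^`().[- l ^+ 3].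
Proof.
rewrite /line_poly deriv_comp hornerM horner_comp !hornerN hornerXn derivN hornerN.
rewrite derivXn hornerMn hornerXn /=; ring.
Qed.

End Sizes.

(** * The eighteen lines meeting ell *)

Section GeneralLines.
Variable K : closedFieldType.
Hypotheses (two0 : 2 != 0 :> K) (three0 : 3 != 0 :> K).
Variables (q : 'rV[K]_3) (g : 'rV[K]_5).

Definition node_poly_of : {poly K} :=
  node_poly (g 0 (inord 0)) (g 0 (inord 1)) (g 0 (inord 2))
    (g 0 (inord 3)) (g 0 (inord 4)).
Definition line_poly_of : {poly K} :=
  line_poly (q 0 (inord 0)) (q 0 (inord 1)) (q 0 (inord 2))
    (g 0 (inord 0)) (g 0 (inord 1)) (g 0 (inord 2)) (g 0 (inord 3)) (g 0 (inord 4)).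

(** The inequalities keep [q] and [g] from vanishing on the planes [x_4 = 0] and
    [x_3 = 0], the tangent planes at the two points of [ell] with [x_1 x_2 = 0]. *)
Definition general : Prop :=
  [/\ [/\ q 0 (inord 0) != 0, q 0 (inord 2) != 0, g 0 (inord 0) != 0
        & g 0 (inord 4) != 0],
      coprimep node_poly_of node_poly_of^`() & coprimep line_poly_of line_poly_of^`()].

Hypothesis gen : general.
Let f := quarticZ q g.

Lemma q0_neq0 : q 0 (inord 0) != 0. Proof. by case: gen => [[]]. Qed.
Lemma q2_neq0 : q 0 (inord 2) != 0. Proof. by case: gen => [[]]. Qed.
Lemma g0_neq0 : g 0 (inord 0) != 0. Proof. by case: gen => [[]]. Qed.
Lemma g4_neq0 : g 0 (inord 4) != 0. Proof. by case: gen => [[]]. Qed.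

Lemma qvals0 s : qval q s 0 = q 0 (inord 0) * s ^+ 2.
Proof. by rewrite /qval /form2; ring. Qed.
Lemma qval0t t : qval q 0 t = q 0 (inord 2) * t ^+ 2.
Proof. by rewrite /qval /form2; ring. Qed.
Lemma gvals0 s : gval g s 0 = g 0 (inord 0) * s ^+ 4.
Proof. by rewrite /gval /form4; ring. Qed.
Lemma gval0t t : gval g 0 t = g 0 (inord 4) * t ^+ 4.
Proof. by rewrite /gval /form4; ring. Qed.

Lemma horner_line_poly_of l : line_poly_of.[l] =
  qval q 1 (- l ^+ 3) ^+ 3 - 27 * l ^+ 3 * gval g 1 (- l ^+ 3).
Proof. exact: horner_line_poly. Qed.

Lemma line_poly_of_0_neq0 : line_poly_of.[0] != 0.
Proof.
rewrite horner_line_poly_of expr0n /= oppr0 qvals0 gvals0 mulr0 mul0r subr0.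
by rewrite expr1n mulr1 expf_neq0 // q0_neq0.
Qed.

Lemma twentyseven_neq0 : 27 != 0 :> K.
Proof. by rewrite (_ : 27 = 3 ^+ 3) ?expf_neq0 //; ring. Qed.

(** The tangency condition gives [k = 3 l (l d - c)], and then
    [c^3 - l^3 d^3 + c d k] is the cube [(c - l d)^3]. *)
Lemma tangent_line_value (l c d k : K) : l != 0 ->
  3 * l ^+ 2 * c + 3 * d * (- l ^+ 3) + l * k = 0 ->
  forall G, c ^+ 3 - l ^+ 3 * d ^+ 3 + c * d * k + G = 0 ->
  k ^+ 3 - 27 * l ^+ 3 * G = 0.
Proof.
move=> l0 E G; have {E}-> : k = 3 * l * (l * d - c).
  by apply: (mulfI l0); apply/eqP; rewrite -subr_eq0 -E; apply/eqP; ring.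
move=> /(canRL (addKr _)) ->; ring.
Qed.

(** The tangent to the residual cubic at [(l : 1 : 0 : 0)], spanned by that point
    and by its point with [x_2 = 0]. *)
Definition lineZ (l : K) : {vspace 'rV[K]_4} :=
  span2 (pt l 1 0 0)
        (pt (- (qval q 1 (- l ^+ 3) / (3 * l))) 0 1 (- l ^+ 3)).

Lemma pt_l1_neq0 (l : K) : pt l 1 0 0 != 0.
Proof. by rewrite pt_eq0 oner_eq0 andbF. Qed.

Lemma is_line_lineZ l : is_line (lineZ l).
Proof.
apply: is_line_span2; first exact: pt_l1_neq0.
by apply: not_ell_line; rewrite mem_pt_ell oner_eq0.
Qed.

Lemma vanishes_lineZ l : line_poly_of.[l] = 0 -> vanishes_on f (lineZ l).
Proof.
have [->|l0] := eqVneq l 0; first by move/eqP; rewrite (negPf line_poly_of_0_neq0).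
rewrite horner_line_poly_of => E v /mem_span2P[x [y ->]].
rewrite meval_quarticZ !mxE !inordK //= !(mulr0, mulr1, add0r, addr0).
set k := qval q 1 _ in E *; set G := gval g 1 _ in E.
rewrite /fval -[y in qval q y _]mulr1 qvalZ -[y in gval g y _]mulr1 gvalZ -/k -/G.
have {E}-> : G = k ^+ 3 / (27 * l ^+ 3).
  have n0 : 27 * l ^+ 3 != 0 by rewrite mulf_neq0 ?twentyseven_neq0 ?expf_neq0.
  by apply: (mulfI n0); rewrite [RHS]mulrC divfK //; apply/eqP;
    rewrite eq_sym -subr_eq0 E.
by field; rewrite l0 three0 twentyseven_neq0.
Qed.

Lemma lineZ_inj : injective lineZ.
Proof.
move=> l m E; have : pt l 1 0 0 \in lineZ m by rewrite -E span2_l.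
move=> /mem_span2P[x [y /rowP e]].
have := e (inord 2); rewrite !mxE !inordK //= mulr0 add0r mulr1 => /esym y0.
have := e (inord 1); rewrite !mxE !inordK //= mulr0 addr0 mulr1 => /esym x1.
by have := e (inord 0); rewrite !mxE !inordK //= y0 x1 mul0r mul1r addr0.
Qed.

Lemma Poly_vanish (s : seq K) : (forall t, (Poly s).[t] = 0) -> forall i, s`_i = 0.
Proof.
move=> E i; rewrite -coef_Poly (_ : Poly s = 0) ?coef0 //.
by apply: poly_eq_fun => t; rewrite E horner0.
Qed.

Lemma ell_coefs_eq0 (M : {vspace 'rV[K]_4}) a b v :
  vanishes_on f M -> pt a b 0 0 \in M -> v \in M ->
  forall i, (ell_coefs q g a b v)`_i = 0.
Proof.
move=> fM PM vM; apply: Poly_vanish => t.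
by rewrite -restrict_quarticZ horner_restrict_line fM // memvD // memvZ.
Qed.

Lemma meets_ellP (M : {vspace 'rV[K]_4}) : meets M ell ->
  exists a b, (pt a b 0 0 \in M) && ((a != 0) || (b != 0)).
Proof.
move/eqP; rewrite -subv0 => /subvPn[P]; rewrite memv_cap memv0 => /andP[PM /ell_pt PE] P0.
exists (P 0 (inord 0)), (P 0 (inord 1)); rewrite -PE PM /=.
by move: P0; rewrite {1}PE pt_eq0 eqxx !andbT negb_and.
Qed.

Lemma line_not_sub_ell (M : {vspace 'rV[K]_4})  :
  is_line M -> M <> ell -> exists2 v, v \in M & v \notin ell.
Proof.
move=> lM Mell; apply/subvPn; apply/negP => sub; apply: Mell; apply/eqP.
rewrite eqEdim sub lM.
suff -> : ell = span2 (pt 1 0 0 0) (pt 0 1 0 0) :> {vspace 'rV[K]_4}.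
  by apply: leq_trans (dimv_add_leqif _ _) _; rewrite !dim_vline; do 2!case: (_ != 0).
apply/vspaceP => v; apply/idP/mem_span2P => [/ell_pt ->|[x [y ->]]].
  exists (v 0 (inord 0)), (v 0 (inord 1)).
  by apply: rV4P; rewrite !mxE !inordK //= !(mulr0, mulr1, addr0, add0r).
by rewrite mem_ell !mxE !inordK //= !mulr0 addr0 eqxx.
Qed.

(** Let [M] join [(a, b, 0, 0)] to [v]. If [v] lay on [x_3 = 0] or [x_4 = 0], the
    coefficients of the restriction to [M] would force [g] to vanish at
    [(0, 1)] or [(1, 0)]. Otherwise the point on [ell] and [v] can be scaled to
    [(l, 1, 0, 0)] and [(c, d, 1, t)], with [t = - l^3]. *)
Lemma line_eq_lineZ (M : {vspace 'rV[K]_4}) :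
  is_line M -> vanishes_on f M -> M <> ell -> meets M ell ->
  exists2 l, line_poly_of.[l] = 0 & M = lineZ l.
Proof.
move=> lM fM Mell /meets_ellP[a [b /andP[PM ab]]].
have [v vM vell] := line_not_sub_ell lM Mell.
have cf := ell_coefs_eq0 fM PM vM.
move: (vell); rewrite mem_ell negb_and => st.
have /= c1 := cf 1%N; have /= c3 := cf 3%N; have /= c4 := cf 4%N.
have s0 : v 0 (inord 2) != 0.
  apply/negP => /eqP s0; move: st c1 c3 c4; rewrite s0 eqxx /= => t0.
  rewrite mulr0 add0r => /eqP; rewrite mulf_eq0 (negPf t0) orbF expf_eq0 /= => /eqP b0.
  move: ab; rewrite b0 eqxx orbF => a0.
  rewrite qval0t !(mulr0, mul0r, addr0, add0r) => /eqP.
  rewrite !mulf_eq0 (negPf a0) (negPf q2_neq0) (negPf t0) !orbF /= => /eqP d0.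
  rewrite /fval d0 gval0t expr0n !(mulr0, mul0r, addr0, add0r) => /eqP.
  by rewrite mulf_eq0 (negPf g4_neq0) (negPf (expf_neq0 _ t0)).
have t0 : v 0 (inord 3) != 0.
  apply/negP => /eqP t0; move: st c1 c3 c4; rewrite t0 s0 /= => _.
  rewrite mulr0 addr0 => /eqP; rewrite mulf_eq0 (negPf s0) orbF expf_eq0 /= => /eqP a0.
  move: ab; rewrite a0 eqxx /= => b0.
  rewrite qvals0 !(mulr0, mul0r, addr0, add0r) => /eqP.
  rewrite !mulf_eq0 (negPf b0) (negPf q0_neq0) (negPf s0) !orbF /= => /eqP c0.
  rewrite /fval c0 gvals0 expr0n !(mulr0, mul0r, addr0, add0r) => /eqP.
  by rewrite mulf_eq0 (negPf g0_neq0) (negPf (expf_neq0 _ s0)).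
have b0 : b != 0.
  apply: contraNneq s0 => b0; move: c1 ab; rewrite b0 expr0n /= mul0r addr0 eqxx orbF.
  by move/eqP; rewrite mulf_eq0 expf_eq0 /= => /orP[->|].
pose l := a / b; pose c := v 0 (inord 0) / v 0 (inord 2).
pose d := v 0 (inord 1) / v 0 (inord 2); pose t := v 0 (inord 3) / v 0 (inord 2).
have P'M : pt l 1 0 0 \in M.
  have -> : pt l 1 0 0 = b^-1 *: pt a b 0 0; last by rewrite memvZ.
  by apply: rV4P; rewrite !mxE !inordK //= ?mulr0 ?mulVf // mulrC.
have v'M : pt c d 1 t \in M.
  have -> : pt c d 1 t = (v 0 (inord 2))^-1 *: v; last by rewrite memvZ.
  by apply: rV4P; rewrite !mxE !inordK //= ?mulVf // mulrC.
have {c1 c3 c4} cf' := ell_coefs_eq0 fM P'M v'M.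
have := cf' 1%N; have := cf' 2%N; have := cf' 4%N; rewrite /= !ptE.
rewrite !expr1n !mulr1 !mul1r => c4 c2 /eqP; rewrite addrC addr_eq0 => /eqP tE.
have l0 : l != 0.
  apply: contraNneq t0 => l0; move/eqP: tE.
  by rewrite l0 expr0n oppr0 /t mulf_eq0 invr_eq0 (negPf s0) orbF.
rewrite tE in c2 c4 v'M.
have lP : line_poly_of.[l] = 0.
  rewrite horner_line_poly_of; apply: (tangent_line_value l0 c2).
  by rewrite -[RHS]c4 /fval; ring.
exists l => //; apply/eqP; rewrite eq_sym eqEdim is_line_lineZ lM leqnn andbT.
apply: span2_sub => //; set V := pt _ _ _ _.
suff -> : V = pt c d 1 (- l ^+ 3) - d *: pt l 1 0 0 by rewrite memvB // memvZ.
have n3l : 3 * l != 0 by rewrite mulf_neq0.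
apply: rV4P; rewrite !mxE !inordK //= ?mulr0 ?mulr1 ?subr0 ?subrr //.
apply: (mulIf n3l); rewrite mulNr divfK //.
by apply: (mulfI l0); apply/eqP; rewrite -subr_eq0 -oppr_eq0 -c2; apply/eqP; ring.
Qed.

(** A separable polynomial of degree 18 over an algebraically closed field has 18
    roots, and [lineZ] is injective because [lineZ l] meets [ell] at
    [(l : 1 : 0 : 0)] only. *)
Lemma eighteen_lines : exists s : seq {vspace 'rV[K]_4},
  [/\ uniq s, size s = 18%N
    & forall M, M \in s <-> [/\ is_line M, vanishes_on f M, M <> ell & meets M ell]].
Proof.
have [r rE] := closed_field_poly_normal line_poly_of.
have sz : size line_poly_of = 19 by apply: size_line_poly; exact: q2_neq0.
have lc0 : lead_coef line_poly_of != 0 by rewrite lead_coef_eq0 -size_poly_eq0 sz.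
exists (map lineZ r); split.
- rewrite (map_inj_uniq lineZ_inj) -separable_prod_XsubC.
  have : separable_poly line_poly_of by rewrite unlock; case: gen.
  rewrite {1}rE.
  by rewrite (eqp_separable (eqp_scale _ lc0)).
- rewrite size_map; have := sz; rewrite {1}rE size_scale // size_prod_XsubC.
  by case.
have rP l : (l \in r) = (line_poly_of.[l] == 0).
  rewrite {1}rE hornerZ mulf_eq0 (negPf lc0) /= -[_ == 0]/(root _ _).
  by rewrite root_prod_XsubC.
move=> M; split => [/mapP[l lr ->]|[lM fM Ml me]].
  move: lr; rewrite rP => /eqP lr; split; first exact: is_line_lineZ.
  - exact: vanishes_lineZ.
  - move=> E; have := span2_r (pt l 1 0 0)
      (pt (- (qval q 1 (- l ^+ 3) / (3 * l))) 0 1 (- l ^+ 3)).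
    by rewrite -/(lineZ l) E mem_pt_ell oner_eq0.
  - move=> E; have := pt_l1_neq0 l; rewrite -memv0 -E memv_cap span2_l mem_pt_ell.
    by rewrite eqxx.
by have [l lr ->] := line_eq_lineZ lM fM Ml me; rewrite map_f // rP lr.
Qed.

End GeneralLines.

(** * Smoothness *)

Lemma mderiv_eq0 (K : fieldType) (p : {mpoly K[4]}) v (H : {vspace 'rV[K]_4}) i :
  (H <= tangent_space p v)%VS -> delta_mx 0 i \in H -> (p^`M(i)).@[v 0] = 0.
Proof.
move=> /subvP sub /sub; rewrite mem_tangent_space (bigD1 i) //= big1 => [|j ji].
  by rewrite addr0 mxE !eqxx mul1r => /eqP.
by rewrite mxE (negPf ji) andbF mul0r.
Qed.

Section GeneralSmoothness.
Variable K : closedFieldType.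
Hypotheses (two0 : 2 != 0 :> K) (three0 : 3 != 0 :> K).
Variables (q : 'rV[K]_3) (g : 'rV[K]_5).
Hypothesis gen : general q g.
Let f := quarticZ q g.
Let q00 := q0_neq0 gen.
Let q20 := q2_neq0 gen.
Let g40 := g4_neq0 gen.

(** By Euler's identity a common zero of both partial derivatives of [g] is a zero
    of [g], hence a double root of [g(1, t)]. *)
Lemma node_poly_simple_root (c d : K) : c != 0 ->
  4 * g 0 (inord 0) * c ^+ 3 + 3 * g 0 (inord 1) * c ^+ 2 * d
     + 2 * g 0 (inord 2) * c * d ^+ 2 + g 0 (inord 3) * d ^+ 3 = 0 ->
  g 0 (inord 1) * c ^+ 3 + 2 * g 0 (inord 2) * c ^+ 2 * d
     + 3 * g 0 (inord 3) * c * d ^+ 2 + 4 * g 0 (inord 4) * d ^+ 3 = 0 -> False.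
Proof.
move=> c0 E3 E4; have [_ sep _] := gen.
have four0 : 4 != 0 :> K by rewrite (_ : 4 = 2 ^+ 2) ?expf_neq0 //; ring.
have : root (node_poly_of g) (d / c).
  apply/rootP; rewrite horner_node_poly /form4.
  apply: (mulfI (mulf_neq0 four0 (expf_neq0 4 c0))).
  rewrite mulr0; transitivity (c * 0 + d * 0 : K); last by rewrite !mulr0 addr0.
  by rewrite -{1}E3 -E4; field; rewrite c0.
move/(coprimep_root sep); rewrite horner_deriv_node_poly => /eqP; apply.
apply: (mulfI (expf_neq0 3 c0)); rewrite mulr0 -[RHS]E4.
by field; rewrite c0.
Qed.

(** The second equation is the derivative of [q^3 + 27 x_3 x_4 g] in [x_4]; through
    [t = - l^3] a double root of this form gives a double root in [l]. *)
Lemma triangle_simple_root (c d k : K) : c != 0 -> d != 0 -> k = qval q c d ->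
  k ^+ 3 + 27 * c * d * gval g c d = 0 ->
  3 * k ^+ 2 * (q 0 (inord 1) * c + 2 * q 0 (inord 2) * d)
  + 27 * c * gval g c d + 27 * c * d *
     (g 0 (inord 1) * c ^+ 3 + 2 * g 0 (inord 2) * c ^+ 2 * d
     + 3 * g 0 (inord 3) * c * d ^+ 2 + 4 * g 0 (inord 4) * d ^+ 3) = 0 -> False.
Proof.
move=> c0 d0 -> E E'; have [_ _ sep] := gen.
have [l l3] := cube_root (- (d / c)).
have c6 := expf_neq0 6 c0; have c5 := expf_neq0 5 c0.
have : root (line_poly_of q g) l.
  apply/rootP; rewrite horner_line_poly_of l3 opprK; apply: (mulfI c6).
  by rewrite mulr0 -[RHS]E /qval /form2 /gval /form4; field; rewrite c0.
move/(coprimep_root sep);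
  rewrite horner_deriv_line_poly l3 opprK horner_deriv_triangle_poly.
move=> /eqP; apply; rewrite [X in _ * X](_ : _ = 0) ?mulr0 //; apply: (mulfI c5).
by rewrite mulr0 -[RHS]E' /qval /form2 /gval /form4; field; rewrite c0.
Qed.

(** If [x_1 x_2 = 0] at a singular point then [x_1 = x_2 = 0] and [g] has a double
    root there. If not, the first two equations give
    [q^2 = 9 x_3 x_4 x_1 x_2], Euler's identity gives [3 g = - x_1 x_2 q], and
    so [q^3 + 27 x_3 x_4 g] vanishes together with its derivative. *)
Lemma smooth_quarticZ : smooth_surface f.
Proof.
move=> v _ v0 fv; apply/negP => sub.
have D i : (f^`M(i)).@[v 0] = 0 by apply: mderiv_eq0 sub (memvf _).
have [] := mderiv_quarticZ q g v; rewrite !D {D fv sub}.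
move: v0; rewrite {1}[v]rV4_eta pt_eq0.
set a := v 0 (inord 0); set b := v 0 (inord 1).
set c := v 0 (inord 2); set d := v 0 (inord 3).
set k := qval q c d => v0 /esym E0 /esym E1 /esym E2 /esym E3.
have P2 n (x : K) : x ^+ n.+1 = 0 -> x = 0.
  by move/eqP; rewrite expf_eq0 => /eqP.
have xy0 (x y : K) : x * y = 0 -> x != 0 -> y = 0.
  by move/eqP; rewrite mulf_eq0 => /orP[->|/eqP].
have [a0|a0] := eqVneq a 0; have [b0|b0] := eqVneq b 0.
- rewrite a0 b0 !(expr0n, mul0r, mulr0, add0r) /= in E2 E3.
  have [c0|c0] := eqVneq c 0; last exact: (node_poly_simple_root c0 E2 E3).
  move: E3; rewrite c0 !(expr0n, mul0r, mulr0, add0r) /= => /xy0-/(_ _)/P2 d0.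
  move: v0; rewrite a0 b0 c0 d0 ?eqxx //.
  by rewrite mulf_neq0 // (_ : 4 = 2 ^+ 2) ?expf_neq0 //; ring.
- rewrite a0 !(expr0n, mul0r, mulr0, add0r, addr0) /= in E0 E1 E2 E3.
  move: E0 => /xy0/(_ b0) k0.
  move: E1; rewrite -mulrA => /xy0/(_ three0)/eqP;
    rewrite mulf_eq0 expf_eq0 /= (negPf b0) orbF => /eqP d0.
  move: k0; rewrite /k d0 qvals0 => /xy0/(_ q00)/P2 c0.
  by move: E3; rewrite c0 d0 !(expr0n, mul0r, mulr0, add0r, addr0) /= => /P2/eqP;
    rewrite (negPf b0).
- rewrite b0 !(expr0n, mul0r, mulr0, add0r, addr0) /= in E0 E1 E2 E3.
  move: E1 => /xy0/(_ a0) k0.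
  move: E0; rewrite -mulrA => /xy0/(_ three0)/eqP;
    rewrite mulf_eq0 expf_eq0 /= (negPf a0) orbF => /eqP c0.
  move: k0; rewrite /k c0 qval0t => /xy0/(_ q20)/P2 d0.
  by move: E2; rewrite c0 d0 !(expr0n, mul0r, mulr0, add0r, addr0) /= => /P2/eqP;
    rewrite (negPf a0).
have c0 : c != 0.
  apply: contraNneq a0 => c0; move: E0;
    rewrite c0 !(mul0r, mulr0, add0r) => /xy0/(_ b0) k0.
  move: k0; rewrite /k c0 qval0t => /xy0/(_ q20)/P2 d0.
  by move: E2; rewrite c0 d0 !(expr0n, mul0r, mulr0, add0r, addr0) /= => /P2/eqP.
have d0 : d != 0.
  apply: contraNneq b0 => d0; move: E1;
    rewrite d0 !(mul0r, mulr0, add0r) => /xy0/(_ a0) k0.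
  move: k0; rewrite /k d0 qvals0 => /xy0/(_ q00)/P2 c1.
  by move: E3; rewrite c1 d0 !(expr0n, mul0r, mulr0, add0r, addr0) /= => /P2/eqP.
have ab0 := mulf_neq0 a0 b0.
have kk : k ^+ 2 = 9 * c * d * (a * b).
  apply: (mulfI (expf_neq0 2 ab0)).
  have A0 : 3 * c * a ^+ 3 = - (a * b * k) by apply/eqP;
    rewrite -subr_eq0 -[0](mulr0 a) -E0; apply/eqP; ring.
  have B0 : 3 * d * b ^+ 3 = - (a * b * k) by apply/eqP;
    rewrite -subr_eq0 -[0](mulr0 b) -E1; apply/eqP; ring.
  have -> : (a * b) ^+ 2 * k ^+ 2 = (- (a * b * k)) * (- (a * b * k)) by ring.
  by rewrite -{1}A0 -B0; ring.
have G : 3 * gval g c d = - (a * b * k).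
  have four0 : 4 != 0 :> K by rewrite (_ : 4 = 2 ^+ 2) ?expf_neq0 //; ring.
  apply: (mulfI four0); apply/eqP; rewrite -subr_eq0; apply/eqP.
  transitivity (3 * (c * 0 + d * 0) - (a * 0 + b * 0) : K); last by ring.
  rewrite -{1}E2 -{1}E3 -{1}E0 -E1 /k /qval /gval /form2 /form4; ring.
have B0 : 3 * d * b ^+ 3 = - (a * b * k) by apply/eqP;
  rewrite -subr_eq0 -[0](mulr0 b) -E1; apply/eqP; ring.
apply: (triangle_simple_root c0 d0 (erefl _)).
  rewrite -/k; transitivity (k * k ^+ 2 + 9 * c * d * (3 * gval g c d)); first by ring.
  by rewrite G kk; ring.
set g4 := _ + 4 * _ * _ in E3 *; rewrite -/k.
set k4 := _ + 2 * _ * _ in E3 *.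
have -> : g4 = - (b ^+ 3 + a * b * k4) by apply/eqP;
  rewrite -addr_eq0 -[X in _ == X]E3; apply/eqP; ring.
transitivity (3 * k ^+ 2 * k4 + 9 * c * (3 * gval g c d) - 9 * c * (3 * d * b ^+ 3)
   - 27 * c * d * (a * b) * k4); first by ring.
by rewrite G B0 kk; ring.
Qed.

End GeneralSmoothness.

(** * Inflection points of the fibres and Segre's construction *)

Lemma dhomog_meval (R : comNzRingType) n d (p : {mpoly R[n]}) (c : R) (u v : 'I_n -> R) :
  p \is d.-homog -> (forall i, u i = c * v i) -> p.@[u] = c ^+ d * p.@[v].
Proof.
move=> /dhomogP hp uE; rewrite !mevalE mulr_sumr; apply: eq_big_seq => m /hp <-.
rewrite mulrCA; congr (_ * _); rewrite /= mdegE -prodrXr -big_split /=.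
by apply: eq_bigr => i _; rewrite uE exprMn.
Qed.

Lemma linear_meval (K : fieldType) n (p : {mpoly K[n]}) (v : 'I_n -> K) :
  p \is 1.-homog -> p.@[v] = \sum_i p@_U_(i) * v i.
Proof.
move=> hp; have {1}-> : p = \sum_i p@_U_(i) *: 'X_i.
  apply/mpolyP => m; rewrite raddf_sum /=.
  have [/mdeg1P[j /eqP->]|m1] := boolP (mdeg m == 1%N).
    rewrite (bigD1 j) //= big1 => [|i ij]; rewrite mcoeffZ mcoeffX.
      by rewrite eqxx mulr1 addr0.
    by rewrite eq_mnm1 (negPf ij) mulr0.
  rewrite (dhomog_nemf_coeff hp m1) big1 // => i _; rewrite mcoeffZ mcoeffX.
  by case: eqP => [E|_]; [rewrite -E mdeg1 in m1|rewrite mulr0].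
by rewrite raddf_sum /=; apply: eq_bigr => i _; rewrite mevalZ mevalXU.
Qed.

Lemma linear_meval4 (K : fieldType) (p : {mpoly K[4]}) : p \is 1.-homog ->
  exists a b c d, forall x y s t,
    p.@[(pt x y s t) 0] = a * x + b * y + c * s + d * t.
Proof.
move=> hp; exists p@_U_(inord 0), p@_U_(inord 1), p@_U_(inord 2), p@_U_(inord 3).
by move=> x y s t; rewrite (linear_meval _ hp) sum_ord4 !ptE.
Qed.

Lemma is_plane_hyperplane (K : fieldType) (a : 'cV[K]_4) :
  a != 0 -> is_plane (hyperplane a).
Proof.
move=> a0; rewrite /is_plane /hyperplane.
set F := linfun _; have := limg_ker_dim F fullv; rewrite capfv.
have -> : \dim (fullv : {vspace 'rV[K]_4}) = 4%N by rewrite dimvf dim_matrix.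
suff -> : \dim (limg F) = 1%N by rewrite addn1 => -[].
apply/eqP; rewrite eqn_leq; apply/andP; split.
  by apply: leq_trans (dimvS (subvf _)) _; rewrite dimvf dim_matrix.
rewrite lt0n dimv_eq0 -subv0; apply/negP => /subvP sub.
have [i ai] : exists i, a i 0 != 0.
  apply/existsP; apply: contraNT a0; rewrite negb_exists => /forallP a0.
  by apply/eqP/colP => i; rewrite mxE; apply/eqP/negPn.
have := sub _ (memv_img F (memvf (delta_mx 0 i))).
rewrite memv0 lfunE /= -rowE => /eqP/rowP/(_ 0); rewrite !mxE => /eqP.
by rewrite (negPf ai).
Qed.

Section GeneralFibres.
Variable K : closedFieldType.
Hypotheses (two0 : 2 != 0 :> K) (three0 : 3 != 0 :> K).
Variables (q : 'rV[K]_3) (g : 'rV[K]_5).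
Hypothesis gen : general q g.
Let f := quarticZ q g.
Let q00 := q0_neq0 gen.
Let g00 := g0_neq0 gen.

Lemma vanishes_ell : vanishes_on f ell.
Proof.
move=> v; rewrite mem_ell => /andP[/eqP v2 /eqP v3].
by rewrite meval_quarticZ v2 v3 /fval qvals0 gvals0 !expr0n /=; ring.
Qed.

Lemma is_plane_tangent (a b : K) : (a != 0) || (b != 0) ->
  is_plane (tangent_space f (pt a b 0 0)).
Proof.
move=> ab; apply: is_plane_hyperplane; apply: contraTneq ab => E.
have [_ _ E2 E3] := mderiv_quarticZ q g (pt a b 0 0).
have Z i : (f^`M(i)).@[(pt a b 0 0) 0] = 0.
  by move/colP/(_ i): E; rewrite [LHS]mxE [RHS]mxE.
move: E2 E3; rewrite !Z !ptE !(mulr0, expr0n, addr0) => /esym/eqP.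
by rewrite expf_eq0 /= => -> /esym/eqP; rewrite expf_eq0 /= => ->.
Qed.

Lemma mem_tangent_l1 l w : (w \in tangent_space f (pt l 1 0 0)) =
  (w 0 (inord 3) == - l ^+ 3 * w 0 (inord 2)).
Proof. by rewrite mem_tangent_ell expr1n mul1r addrC addr_eq0 mulNr. Qed.

Definition fiber l : {mpoly K[4]} :=
  cubicZ 1 0 1 (- l ^+ 3) (qval q 1 (- l ^+ 3)) (gval g 1 (- l ^+ 3)).

Lemma residual_fiber l : residual_cubic f ell (tangent_space f (pt l 1 0 0)) (fiber l).
Proof.
apply: residual_cubicZ => //=.
  by move=> w; rewrite mem_tangent_l1 expr0 expr1 mulr1 mul1r => /eqP.
exists (pt 0 0 1 (- l ^+ 3)); first by rewrite mem_tangent_l1 !ptE mulr1.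
by rewrite !ptE expr0 expr1 mulr1 oner_eq0.
Qed.

Lemma mderiv_cubicZ (s t k m : K) (v : 'rV[K]_4)
   (a := v 0 (inord 0)) (b := v 0 (inord 1)) (c := v 0 (inord 2)) :
  [/\ ((cubicZ 1 0 s t k m)^`M(inord 0)).@[v 0] = 3 * s * a ^+ 2 + k * b * c,
      ((cubicZ 1 0 s t k m)^`M(inord 1)).@[v 0] = 3 * t * b ^+ 2 + k * a * c,
      ((cubicZ 1 0 s t k m)^`M(inord 2)).@[v 0] = k * a * b + 3 * m * c ^+ 2
    & ((cubicZ 1 0 s t k m)^`M(inord 3)).@[v 0] = 0].
Proof.
rewrite /cubicZ.
split; rewrite !(mderivD, mderivZ, mderiv_mon) !(mevalD, mevalZ, meval_mon);
rewrite -/a -/b -/c /=; ring.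
Qed.

(** At a singular point, multiplying the three partial equations gives
    [(q^3 - 27 l^3 g) (x_1 x_2 x_3)^2 = 0], and a singular point with
    [x_1 x_2 x_3 = 0] has all coordinates zero. *)
Lemma smooth_fiber l :
  l != 0 -> gval g 1 (- l ^+ 3) != 0 -> (line_poly_of q g).[l] != 0 ->
  smooth_in (tangent_space f (pt l 1 0 0)) (fiber l).
Proof.
move=> l0 G0; rewrite horner_line_poly_of => D0 v vH v0 _; apply/negP => /subvP sub.
have [E0 E1 E2 E3] := mderiv_cubicZ 1 (- l ^+ 3) (qval q 1 (- l ^+ 3))
  (gval g 1 (- l ^+ 3)) v.
have S w : w \in tangent_space f (pt l 1 0 0) -> _ := fun H => sub w H.
have := S (pt 0 0 1 (- l ^+ 3)); rewrite mem_tangent_l1 !ptE mulr1 => /(_ (eqxx _)).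
have := S (pt 1 0 0 0); rewrite mem_tangent_l1 !ptE mulr0 => /(_ (eqxx _)).
have := S (pt 0 1 0 0); rewrite mem_tangent_l1 !ptE mulr0 => /(_ (eqxx _)).
rewrite !mem_tangent_space !sum_ord4 !ptE E0 E1 E2 E3 {E0 E1 E2 E3 S sub}.
rewrite !(mul0r, mul1r, add0r, addr0, mulr0) mulr1.
move: v0 vH D0 G0; rewrite mem_tangent_l1 {1}[v]rV4_eta pt_eq0.
set k := qval _ _ _; set m := gval _ _ _.
set a := v 0 (inord 0); set b := v 0 (inord 1).
set c := v 0 (inord 2); set d := v 0 (inord 3).
move=> v0 /eqP dE D0 m0 /eqP E1 /eqP E0 /eqP E2.
have P2 n (x : K) : x ^+ n.+1 = 0 -> x = 0.
  by move/eqP; rewrite expf_eq0 => /eqP.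
have xy0 (x y : K) : x * y = 0 -> x != 0 -> y = 0.
  by move/eqP; rewrite mulf_eq0 => /orP[->|/eqP].
have abc : a * b * c = 0.
  apply: (@P2 1%N); apply: xy0 D0; apply/eqP.
  have A0 : 3 * a ^+ 2 = - (k * b * c) by apply/eqP; rewrite -addr_eq0 E0.
  have B0 : 3 * l ^+ 3 * b ^+ 2 = k * a * c by apply/eqP;
    rewrite -subr_eq0 -oppr_eq0 -E1; apply/eqP; ring.
  have C0 : 3 * m * c ^+ 2 = - (k * a * b) by apply/eqP; rewrite -addr_eq0 addrC E2.
  rewrite mulrBl subr_eq0 eq_sym; apply/eqP.
  transitivity ((3 * a ^+ 2) * (3 * l ^+ 3 * b ^+ 2) * (3 * m * c ^+ 2)); first by ring.
  by rewrite A0 B0 C0; ring.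
have c0 : c = 0.
  move/eqP: abc; rewrite mulf_eq0 => /orP[/eqP ab|/eqP//].
  move: E2; rewrite -mulrA ab mulr0 add0r -mulrA => /xy0/(_ three0)/xy0/(_ m0)/P2 //.
rewrite c0 !mulr0 !addr0 in E0 E1 dE.
move: v0; rewrite c0 dE.
move: E0 => /xy0/(_ three0)/P2->.
have l30 : 3 * - l ^+ 3 != 0 by rewrite mulf_neq0 // oppr_eq0 expf_neq0.
by move: E1 => /xy0/(_ l30)/P2->; rewrite eqxx.
Qed.

(** The tangent [lineZ q l] has contact of order three: the cubic restricts to it as
    a multiple of the cube of the coordinate [x_3]. *)
Lemma fiber_inflection l :
  l != 0 -> gval g 1 (- l ^+ 3) != 0 -> (line_poly_of q g).[l] != 0 ->
  smooth_fiber_inflection f ell (pt l 1 0 0).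
Proof.
move=> l0 G0 D0; exists (tangent_space f (pt l 1 0 0)), (fiber l).
have PH : pt l 1 0 0 \in tangent_space f (pt l 1 0 0).
  by rewrite mem_tangent_l1 !ptE mulr0.
split.
- by apply: is_plane_tangent; rewrite oner_eq0 orbT.
- apply/subvP => w /ell_pt ->; by rewrite mem_tangent_l1 !ptE mulr0.
- exact: residual_fiber.
- exact: smooth_fiber.
split=> //; first exact: pt_l1_neq0.
exists (lineZ q l); split; first exact: is_line_lineZ.
  by apply: span2_sub => //; rewrite mem_tangent_l1 !ptE mulr1.
split; first exact: span2_l.
move=> w /mem_span2P[x [y ->]].
rewrite (_ : restrict_line _ _ _ =
  (y ^+ 3 * (gval g 1 (- l ^+ 3) - (qval q 1 (- l ^+ 3) / (3 * l)) ^+ 3))%:P * 'X^3).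
  exact: dvdp_mull.
apply: poly_eq_fun => T; rewrite horner_restrict_line meval_cubicZ.
rewrite !mxE !inordK //= hornerM hornerC hornerXn.
by field; rewrite l0 three0.
Qed.

(** All but finitely many points of [ell] are inflection points of smooth fibres, so
    a form vanishing at these points vanishes on [ell]; here [bad] collects the
    excluded values of [l]. *)
Lemma second_kind_ell : second_kind f ell.
Proof.
move=> v /ell_pt -> _ d p hp van.
pose bad : {poly K} := 'X * (line_poly_of q g * (node_poly_of g \Po (- 'X^3))).
have bad0 : bad != 0.
  rewrite !mulf_neq0 ?polyX_eq0 //.
    by apply: contraNneq (line_poly_of_0_neq0 gen) => ->; rewrite horner0.
  apply: contraTneq g00 => E; have := congr1 (horner^~ 0) E.
  rewrite /= horner_comp hornerN hornerXn expr0n oppr0 horner0 /node_poly_of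
    horner_node_poly => E0.
  by rewrite -E0 /form4 negbK; apply/eqP; ring.
have l1 l : p.@[(pt l 1 0 0) 0] = 0.
  pose r := mmap polyC (fun i : 'I_4 => nth 0 [:: 'X; 1; 0; 0] i) p.
  have rE t : r.[t] = p.@[(pt t 1 0 0) 0].
    rewrite mmap_polyC_horner; apply: meval_eq; apply: ord4P; rewrite ptE inordK //=.
    - exact: hornerX.
    - exact: hornerC.
    - exact: horner0.
    - exact: horner0.
  suff r0 : r = 0 by rewrite -rE r0 horner0.
  suff /eqP : r * bad = 0 by rewrite mulf_eq0 (negPf bad0) orbF => /eqP.
  apply: poly_eq_fun => t; rewrite horner0 hornerM rE.
  have [->|] := eqVneq bad.[t] 0; first by rewrite mulr0.
  rewrite /bad hornerM hornerX hornerM [(node_poly_of g \Po _).[t]]horner_comp hornerN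
    hornerXn /node_poly_of horner_node_poly.
  rewrite !mulf_eq0 !negb_or => /and3P[t0 D0 G0].
  by rewrite van ?mul0r //; apply: fiber_inflection.
(* Homogeneity covers the points with nonzero second coordinate, and a second
   polynomial argument the remaining point (1 : 0 : 0 : 0). *)
have ab a b : b != 0 -> p.@[(pt a b 0 0) 0] = 0.
  move=> b0; rewrite (@dhomog_meval _ _ d _ b _ ((pt (a / b) 1 0 0) 0)) ?l1 ?mulr0 //.
  by apply: ord4P; rewrite !ptE ?mulr0 ?mulr1 // mulrC divfK.
set a := v 0 (inord 0); set b := v 0 (inord 1).
have [->|] := eqVneq b 0; last exact: ab.
pose r := mmap polyC (fun i : 'I_4 => nth 0 [:: a%:P; 'X; 0; 0] i) p.
have rE t : r.[t] = p.@[(pt a t 0 0) 0].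
  rewrite mmap_polyC_horner; apply: meval_eq; apply: ord4P; rewrite ptE inordK //=.
  - exact: hornerC.
  - exact: hornerX.
  - exact: horner0.
  - exact: horner0.
suff r0 : r = 0 by rewrite -rE r0 horner0.
suff /eqP : r * 'X = 0 by rewrite mulf_eq0 polyX_eq0 orbF => /eqP.
apply: poly_eq_fun => t; rewrite horner0 hornerM rE hornerX.
by have [->|/ab ->] := eqVneq t 0; rewrite ?mulr0 ?mul0r.
Qed.

(** On the plane [(1 : t)] the quartic [S] is [c] times a quartic of the same shape
    with [g(1,t)] replaced by [g(1,t) - L(t) / c]. For a [t] with [t D(t) <> 0]
    there is no line of [V(S)] through the point [(x : 0 : 1 : t)] of [V(S)]. *)
Lemma not_segre : ~ segre_construction f ell.
Proof.
move=> [S [l [c [c0 E [_ _ [F [FM FS]]] lh lell]]]].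
have l12 i x y s t : (l i).@[(pt x y s t) 0] = (l i).@[(pt 0 0 s t) 0].
  have [/linear_meval4[A [B [C [D lE]]]] _] := lh i; rewrite !lE.
  have /lell/(_ i) : pt 1 0 0 0 \in (ell : {vspace 'rV[K]_4}) by rewrite mem_pt_ell eqxx.
  have /lell/(_ i) : pt 0 1 0 0 \in (ell : {vspace 'rV[K]_4}) by rewrite mem_pt_ell eqxx.
  rewrite !lE !(mulr0, mulr1, addr0, add0r) => -> ->.
  by rewrite !mul0r !add0r.
pose L : {poly K} := \prod_i mmap polyC (fun j : 'I_4 => nth 0 [:: 0; 0; 1; 'X] j) (l i).
have LE x y t : (\prod_i l i).@[(pt x y 1 t) 0] = L.[t].
  rewrite rmorph_prod /= horner_prod; apply: eq_bigr => i _; rewrite l12.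
  rewrite mmap_polyC_horner; apply: meval_eq; apply: ord4P; rewrite ptE inordK //=.
  - by rewrite horner0.
  - by rewrite horner0.
  - by rewrite hornerC.
  - by rewrite hornerX.
(* The form q^3 + 27 t g' for the modified quartic. It is not zero, because its
   value at t = 0 is that of q^3. *)
pose D : {poly K} := triangle_poly (q 0 (inord 0)) (q 0 (inord 1)) (q 0 (inord 2))
    (g 0 (inord 0)) (g 0 (inord 1)) (g 0 (inord 2)) (g 0 (inord 3)) (g 0 (inord 4))
    - (27 / c)%:P * 'X * L.
have DE t : D.[t] = qval q 1 t ^+ 3 + 27 * t * (gval g 1 t - L.[t] / c).
  rewrite /D hornerD horner_triangle_poly hornerN hornerM hornerM hornerC hornerX.
  by rewrite /qval /gval; field.
have [t] : exists t, ('X * D).[t] != 0.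
  apply/closed_nonrootP; rewrite mulf_neq0 ?polyX_eq0 //; apply/eqP => D0.
  have := DE 0; rewrite D0 horner0 qvals0 mulr0 mul0r addr0 expr1n mulr1 => /esym/eqP.
  by rewrite expf_eq0 (negPf q00).
rewrite hornerM hornerX mulf_eq0 negb_or => /andP[t0 Dt0].
have [x x3] := cube_root (L.[t] / c - gval g 1 t).
pose v := pt x 0 1 t.
have SE w : S.@[w 0] = c * f.@[w 0] - (\prod_i l i).@[w 0].
  by apply/eqP; rewrite eq_sym subr_eq -mevalD -E mevalZ.
have Sv : S.@[v 0] = 0.
  rewrite SE LE meval_quarticZ !ptE /fval x3 expr0n /=; by field.
have v0 : v != 0 by rewrite pt_eq0 oner_eq0 !andbF.
have [M FMM vM] := (FS v v0).1 Sv.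
have [lM /meets_ellP[a [b /andP[PM ab]]]] := FM M FMM.
pose R := restrict_line f (pt a b 0 0) v.
have fT T : c * R.[T] = T ^+ 4 * L.[t].
  have wM : pt a b 0 0 + T *: v \in M by rewrite memvD ?memvZ.
  have S0 : S.@[(pt a b 0 0 + T *: v) 0] = 0.
    apply/(FS _ _); last by exists M.
    rewrite ptDZ pt_eq0 !add0r mulr1.
    by apply: contraL ab => /and4P[/eqP aE /eqP bE /eqP T0 _]; move: aE bE;
      rewrite T0 !mul0r !addr0 => -> ->; rewrite eqxx.
  move/eqP: S0; rewrite SE subr_eq0 horner_restrict_line => /eqP ->.
  have -> : T ^+ 4 = \prod_(i < 4) T by rewrite prodr_const card_ord.
  rewrite -(LE 0 0) !rmorph_prod /= -big_split /=.
  apply: eq_bigr => i _; rewrite ptDZ l12 !add0r.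
  have [lh1 _] := lh i; rewrite -[T in RHS]expr1; apply: dhomog_meval lh1 _.
  by apply: ord4P; rewrite !ptE ?mulr0.
(* The four planes contain ell, so their product restricts to a multiple of T^4 and
   leaves the lower coefficients of the quartic untouched. *)
have RE : c%:P * R = L.[t]%:P * 'X^4.
  by apply: poly_eq_fun => T; rewrite hornerM hornerC fT hornerM hornerC hornerXn mulrC.
have cf i : (i < 4)%N -> (ell_coefs q g a b v)`_i = 0.
  move=> i4; have := congr1 (fun r : {poly K} => r`_i) RE.
  rewrite !coefCM coefXn (ltn_eqF i4) mulr0 /R restrict_quarticZ coef_Poly => /eqP.
  by rewrite mulf_eq0 (negPf c0) => /eqP.
have /= := cf 1%N isT; have /= := cf 2%N isT; rewrite !ptE !mulr1 => c2 c1.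
have b0 : b != 0.
  apply: contraTneq ab => b0; move: c1; rewrite b0 expr0n mul0r addr0 => /eqP.
  by rewrite expf_eq0 /= => ->; rewrite eqxx.
pose m := a / b.
have tE : t = - m ^+ 3.
  apply: (mulfI (expf_neq0 3 b0)); apply/eqP; rewrite -subr_eq0 -c1; apply/eqP.
  by rewrite /m; field.
have m0 : m != 0.
  by apply: contraNneq t0 => m0; rewrite tE m0 expr0n oppr0.
have c2' : 3 * m ^+ 2 * x + 3 * 0 * (- m ^+ 3) + m * qval q 1 t = 0.
  apply: (mulfI (expf_neq0 2 b0)); rewrite [RHS]mulr0 -[RHS]c2 /m.
  by field.
have c4 : x ^+ 3 - m ^+ 3 * 0 ^+ 3 + x * 0 * qval q 1 t + (gval g 1 t - L.[t] / c) = 0.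
  by rewrite x3; ring.
have := tangent_line_value m0 c2' c4; move/eqP; apply/negP; apply: contraNneq Dt0 => <-.
by rewrite DE tE; apply/eqP; ring.
Qed.

End GeneralFibres.

(** * The surface S_8 *)

Section Sextic.
Variable K : closedFieldType.
Hypotheses (two0 : 2 != 0 :> K) (three0 : 3 != 0 :> K).
Variables (q : 'rV[K]_3) (g : 'rV[K]_5).
Let f := quarticZ q g.

Definition coord_plane (i : nat) : {vspace 'rV[K]_4} := hyperplane (delta_mx (inord i) 0).

Lemma mem_coord_plane i (v : 'rV[K]_4) : (v \in coord_plane i) = (v 0 (inord i) == 0).
Proof.
rewrite mem_hyperplane -colE; apply/eqP/eqP=> [/rowP/(_ 0)|vi]; first by rewrite !mxE.
by apply/rowP=> j; rewrite !mxE vi.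
Qed.

Lemma is_plane_coord i : is_plane (coord_plane i).
Proof.
apply: is_plane_hyperplane; apply/eqP => /colP/(_ (inord i)).
by rewrite !mxE !eqxx => /eqP; rewrite oner_eq0.
Qed.

Lemma coord_planes_neq : coord_plane 2 <> coord_plane 3.
Proof.
move=> E; have := mem_coord_plane 2 (pt 0 0 0 1); rewrite E mem_coord_plane !ptE.
by rewrite oner_eq0 eqxx.
Qed.

(** The norm [q^3 - 27 x_3 x_4 (x_3 x_1^3 + x_4 x_2^3 + x_1 x_2 q)] of
    [3 l x_1 x_3 + 3 l^-1 x_2 x_4 + q] over the three values of [l] with
    [l^3 = - x_4 / x_3]; the inner bracket is the quartic of the family with
    [g = 0]. *)
Definition sextic : {mpoly K[4]} :=
  binary_form q ^+ 3 - 27 *: (x3 K * x4 K * quarticZ q 0).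

Lemma dhomog_sextic : sextic \is 6.-homog.
Proof.
have h1 i : ('X_i : {mpoly K[4]}) \is 1.-homog by rewrite dhomogX; apply/eqP/mdeg1.
apply: rpredB; last apply: dhomogZ.
  apply: (@dhomogMn _ _ _ 2 _ 3); rewrite binary_form2E.
  by rewrite !(rpredD, rpredZ) //;
    [apply: (@dhomogMn _ _ _ 1 _ 2)|apply: (@dhomogM _ _ _ 1 _ 1)
    |apply: (@dhomogMn _ _ _ 1 _ 2)]; exact: h1.
apply: (@dhomogM _ _ _ 2 _ 4).
  by apply: (@dhomogM _ _ _ 1 _ 1); exact: h1.
rewrite quarticZ_mon !rpredD ?rpredZ //; exact: (@dhomog_mon K).
Qed.

Lemma meval_sextic (v : 'rV[K]_4) (a := v 0 (inord 0)) (b := v 0 (inord 1))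
   (c := v 0 (inord 2)) (d := v 0 (inord 3)) : sextic.@[v 0] =
  qval q c d ^+ 3 - 27 * (c * d * (c * a ^+ 3 + d * b ^+ 3 + a * b * qval q c d)).
Proof.
rewrite /sextic mevalB rmorphXn /= meval_form2 mevalZ mevalM mevalM meval_quarticZ.
rewrite /x3 /x4 !mevalXU -/a -/b -/c -/d /fval.
suff -> : gval 0 c d = 0 :> K by rewrite addr0.
by rewrite /gval /form4 !mxE; ring.
Qed.

(** If [A + B + C = 0] then [A^3 + B^3 + C^3 = 3 A B C]; here
    [A], [B], [C] are the three terms of the second hypothesis. *)
Lemma sextic_of_tangent (a b c d s t k : K) : a != 0 -> b != 0 ->
  a ^+ 3 * s + b ^+ 3 * t = 0 ->
  3 * a ^+ 2 * c * s + 3 * b ^+ 2 * d * t + a * b * k = 0 ->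
  k ^+ 3 - 27 * (s * t * (s * c ^+ 3 + t * d ^+ 3 + c * d * k)) = 0.
Proof.
move=> a0 b0 E1 E2; apply: (mulfI (expf_neq0 3 (mulf_neq0 a0 b0))); rewrite mulr0.
have A3 : a ^+ 3 * s = - (b ^+ 3 * t) by apply/eqP; rewrite -addr_eq0 E1.
have K1 : a * b * k = - (3 * a ^+ 2 * c * s + 3 * b ^+ 2 * d * t).
  by apply/eqP; rewrite -addr_eq0 addrC E2.
transitivity ((a * b * k) ^+ 3 - 27 * (a ^+ 3 * s) * (b ^+ 3 * t) 
     * (s * c ^+ 3 + t * d ^+ 3)
   - 27 * (a ^+ 2 * c * s) * (b ^+ 2 * d * t) * (a * b * k)); first by ring.
rewrite K1 {1}A3.
transitivity (27 * c ^+ 3 * s * ((b ^+ 3 * t) ^+ 2 - (a ^+ 3 * s) ^+ 2)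
  + 27 * d ^+ 3 * t * (b ^+ 3 * t) * (b ^+ 3 * t - b ^+ 3 * t)); first by ring.
by rewrite A3; ring.
Qed.

(** With [w] a primitive cube root of unity, the left-hand sides of the tangency
    condition for [l], [w l], [w^2 l] multiply to [l^3] times that of the sextic. *)
Lemma tangent_of_sextic (c d s t k : K) : s != 0 -> t != 0 ->
  k ^+ 3 - 27 * (s * t * (s * c ^+ 3 + t * d ^+ 3 + c * d * k)) = 0 ->
  exists l, l ^+ 3 * s + t = 0 /\ 3 * l ^+ 2 * c * s + 3 * d * t + l * k = 0.
Proof.
move=> s0 t0 E; have [l l3] := cube_root (- (t / s)).
have ls : l ^+ 3 * s = - t by rewrite l3 mulNr divfK.
have [w] := solve_monicpoly (n := 2%N) (fun=> - 1 : K) isT.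
rewrite !big_ord_recl big_ord0 /= /bump /= expr0 expr1 mulr1 addr0 mulN1r => ww.
have w3 : w ^+ 3 = 1.
  transitivity (w * w ^+ 2); first by ring.
  by rewrite ww mulrDr mulrN1 mulrN -expr2 ww; ring.
pose F (x : K) : K := 3 * x ^+ 2 * c * s + 3 * d * t + x * k.
have FE : F l * F (w * l) * F (w ^+ 2 * l) = 0.
  transitivity (l ^+ 3 * (k ^+ 3 - 27 * 
    (s * t * (s * c ^+ 3 + t * d ^+ 3 + c * d * k)))); last by rewrite E mulr0.
  have F1 : F (w * l) = (-1 - w) * (3 * l ^+ 2 * c * s) + 3 * d * t + w * (l * k).
    by rewrite -ww /F; ring.
  have F2 : F (w ^+ 2 * l) = w * (3 * l ^+ 2 * c * s) + 3 * d * t + (-1 - w) * (l * k).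
    rewrite -ww /F -[w in w * (3 * _ * _ * _)]mul1r -w3; ring.
  rewrite F1 F2 /F; pose a := 3 * l ^+ 2 * c * s; pose b := 3 * d * t; pose e := l * k.
  transitivity (a ^+ 3 + b ^+ 3 + e ^+ 3 - 3 * a * b * e); first by rewrite /a /b /e;
    ring: ww.
  transitivity (27 * (l ^+ 3 * s) ^+ 2 * s * c ^+ 3 + b ^+ 3 + e ^+ 3
    - 27 * (l ^+ 3 * s) * c * d * t * k).
    by rewrite /a /b /e; ring.
  rewrite [in RHS]mulrBr.
  transitivity (l ^+ 3 * k ^+ 3 - 27 * (l ^+ 3 * s) * t
    * (s * c ^+ 3 + t * d ^+ 3 + c * d * k)); last by ring.
  by rewrite ls /b /e; ring.
move/eqP: FE; rewrite !mulf_eq0 -orbA => /or3P[] /eqP F0.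
- by exists l; rewrite ls addNr.
- by exists (w * l); rewrite exprMn w3 mul1r ls addNr.
- by exists (w ^+ 2 * l); rewrite exprMn exprAC w3 expr1n mul1r ls addNr.
Qed.

(** Tangency of [M] to the residual cubic at [P] raises by one, through the equation
    of [ell], to contact of order at least three with the quartic, whichever equation
      of the
    cubic is used. *)
Lemma S8_sextic (v : 'rV[K]_4) : S8 f ell v ->
  [\/ v \in coord_plane 2, v \in coord_plane 3 | sextic.@[v 0] = 0].
Proof.
move=> [M [lM [P [c [/ell_pt PE P0 /subvP MT [_ [h [_ h0 _ fhc]]] [PM cM]]]]] vM].
set a := P 0 (inord 0) in PE; set b := P 0 (inord 1) in PE.
have := MT _ vM; rewrite {1}PE mem_tangent_ell.
have [a0|a0] := eqVneq a 0.
  move: P0; rewrite PE a0 pt_eq0 eqxx /= andbT => b0.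
  rewrite expr0n mul0r add0r mulf_eq0 expf_eq0 (negPf b0) andbF => v3.
  by apply: Or32; rewrite mem_coord_plane.
have [b0|b0] := eqVneq b 0.
  rewrite b0 expr0n mul0r addr0 mulf_eq0 expf_eq0 (negPf a0) andbF => v2.
  by apply: Or31; rewrite mem_coord_plane.
move/eqP => c1; apply: Or33.
have E : restrict_line f P v = restrict_line h P v * restrict_line c P v.
  apply: poly_eq_fun => T; rewrite hornerM !horner_restrict_line fhc // MT //.
  by rewrite memvD ?memvZ.
have dvd_h : 'X^1 %| restrict_line h P v.
  apply/dvdp_Xn_coef => -[|//] _; rewrite -horner_coef0 horner_restrict_line.
  by rewrite scale0r addr0 h0 // PE mem_pt_ell eqxx.
have : 'X^3 %| restrict_line f P v.
  by rewrite E -[3%N]/(1 + 2)%N exprD dvdp_mul // cM.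
move/dvdp_Xn_coef/(_ 2%N isT); rewrite PE restrict_quarticZ coef_Poly /= => c2.
by rewrite meval_sextic; apply: sextic_of_tangent c1 c2.
Qed.

Lemma line_through (P e v : 'rV[K]_4) (H : {vspace 'rV[K]_4}) :
  P != 0 -> e \notin <[P]>%VS -> P \in H -> e \in H -> v \in H ->
  exists M, [/\ is_line M, P \in M, (M <= H)%VS & v \in M].
Proof.
move=> P0 eP PH eH vH; have [vP|vP] := boolP (v \in <[P]>%VS).
  exists (span2 P e); split; [exact: is_line_span2|exact: span2_l|exact: span2_sub|].
  by case/vlineP: vP => x ->; rewrite memvZ // span2_l.
by exists (span2 P v); split;
  [exact: is_line_span2|exact: span2_l|exact: span2_sub|exact: span2_r].
Qed.

(** At [(1 : 0 : 0 : 0)] the residual cubic is singular, so every line of the tangent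
    plane through this point is admissible. *)
Lemma S8_coord_plane2 (v : 'rV[K]_4) : v \in coord_plane 2 -> S8 f ell v.
Proof.
move=> vH; have T w : (w \in tangent_space f (pt 1 0 0 0)) = (w 0 (inord 2) == 0).
  by rewrite mem_tangent_ell expr1n expr0n mul1r mul0r addr0.
have P0 : pt 1 0 0 0 != 0 :> 'rV[K]_4 by rewrite pt_eq0 oner_eq0.
have eP : pt 0 0 0 1 \notin <[pt 1 0 0 0 : 'rV[K]_4]>%VS.
  by apply: not_ell_line; rewrite mem_pt_ell oner_eq0 andbF.
have vT : v \in tangent_space f (pt 1 0 0 0) by rewrite T -mem_coord_plane.
have [||M [lM PM MT vM]] := line_through P0 eP _ _ vT; rewrite ?T ?ptE //.
exists M => //; split => //.
exists (pt 1 0 0 0), (cubicZ 0 1 0 1 (qval q 0 1) (gval g 0 1)); split => //.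
- by rewrite mem_pt_ell eqxx.
- apply: residual_cubicZ => //=.
    by move=> w; rewrite T => /eqP->; rewrite expr0 expr1 !mul1r mul0r.
  by exists (pt 0 0 0 1); rewrite ?T !ptE // expr0 expr1 mul1r oner_eq0.
split=> // w /(subvP MT); rewrite T => /eqP w2.
set x := w 0 (inord 0); set y := w 0 (inord 1); set z := w 0 (inord 3).
set k := qval q 0 1; set m := gval g 0 1.
rewrite (_ : restrict_line _ _ _ =
   ((k * y * z)%:P + (y ^+ 3 + k * x * y * z + m * z ^+ 3)%:P * 'X) * 'X^2).
  exact: dvdp_mull.
apply: poly_eq_fun => U; rewrite horner_restrict_line meval_cubicZ.
rewrite hornerM hornerD hornerM !hornerC hornerX hornerXn.
rewrite !mxE !inordK //= -/x -/y -/z w2; ring.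
Qed.

Lemma S8_coord_plane3 (v : 'rV[K]_4) : v \in coord_plane 3 -> S8 f ell v.
Proof.
move=> vH; have T w : (w \in tangent_space f (pt 0 1 0 0)) = (w 0 (inord 3) == 0).
  by rewrite mem_tangent_ell expr1n expr0n mul1r mul0r add0r.
have P0 : pt 0 1 0 0 != 0 :> 'rV[K]_4 by rewrite pt_eq0 oner_eq0 andbF.
have eP : pt 0 0 1 0 \notin <[pt 0 1 0 0 : 'rV[K]_4]>%VS.
  by apply: not_ell_line; rewrite mem_pt_ell oner_eq0.
have vT : v \in tangent_space f (pt 0 1 0 0) by rewrite T -mem_coord_plane.
have [||M [lM PM MT vM]] := line_through P0 eP _ _ vT; rewrite ?T ?ptE //.
exists M => //; split => //.
exists (pt 0 1 0 0), (cubicZ 1 0 1 0 (qval q 1 0) (gval g 1 0)); split => //.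
- by rewrite mem_pt_ell eqxx.
- apply: residual_cubicZ => //=.
    by move=> w; rewrite T => /eqP->; rewrite expr0 expr1 mulr1 !mul1r mul0r.
  by exists (pt 0 0 1 0); rewrite ?T !ptE // expr0 expr1 mulr1 oner_eq0.
split=> // w /(subvP MT); rewrite T => /eqP w2.
set x := w 0 (inord 0); set y := w 0 (inord 1); set z := w 0 (inord 2).
set k := qval q 1 0; set m := gval g 1 0.
rewrite (_ : restrict_line _ _ _ =
   ((k * x * z)%:P + (x ^+ 3 + k * x * y * z + m * z ^+ 3)%:P * 'X) * 'X^2).
  exact: dvdp_mull.
apply: poly_eq_fun => U; rewrite horner_restrict_line meval_cubicZ.
rewrite hornerM hornerD hornerM !hornerC hornerX hornerXn.
rewrite !mxE !inordK //= -/x -/y -/z w2; ring.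
Qed.

Lemma S8_of_sextic (v : 'rV[K]_4) : sextic.@[v 0] = 0 -> S8 f ell v.
Proof.
have [s0|s0] := eqVneq (v 0 (inord 2)) 0.
  by move=> _; apply: S8_coord_plane2; rewrite mem_coord_plane s0.
have [t0|t0] := eqVneq (v 0 (inord 3)) 0.
  by move=> _; apply: S8_coord_plane3; rewrite mem_coord_plane t0.
rewrite meval_sextic => /(tangent_of_sextic s0 t0)[l [l3 E]].
have tE : v 0 (inord 3) = - l ^+ 3 * v 0 (inord 2).
  by apply/eqP; rewrite mulNr -addr_eq0 addrC l3.
have vell : v \notin ell by rewrite mem_ell negb_and s0.
have vT : v \in tangent_space f (pt l 1 0 0) by rewrite mem_tangent_l1 tE.
have PT : pt l 1 0 0 \in tangent_space f (pt l 1 0 0).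
  by rewrite mem_tangent_l1 !ptE mulr0.
exists (span2 (pt l 1 0 0) v); last exact: span2_r.
split; first by apply: is_line_span2; [exact: pt_l1_neq0|exact: not_ell_line].
exists (pt l 1 0 0), (fiber q g l); split.
- by rewrite mem_pt_ell eqxx.
- exact: pt_l1_neq0.
- exact: span2_sub.
- exact: residual_fiber.
split; first exact: span2_l.
move=> w /mem_span2P[x [y ->]].
set c := v 0 (inord 0) in E; set d := v 0 (inord 1) in E.
set s := v 0 (inord 2) in s0 E tE; set k := qval q 1 (- l ^+ 3);
  set m := gval g 1 (- l ^+ 3).
have {E} E : 3 * l ^+ 2 * c - 3 * l ^+ 3 * d + l * k * s = 0.
  apply: (mulfI s0); rewrite mulr0 -[RHS]E tE -[s in qval q s _]mulr1
    [- l ^+ 3 * s]mulrC qvalZ -/k.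
  by ring.
pose A := 3 * l * c ^+ 2 - 3 * l ^+ 3 * d ^+ 2 + (l * d + c) * k * s.
pose C := c ^+ 3 - l ^+ 3 * d ^+ 3 + c * d * s * k + m * s ^+ 3.
rewrite (_ : restrict_line _ _ _ =
   ((y ^+ 2 * A)%:P * (1 + x%:P * 'X) + (y ^+ 3 * C)%:P * 'X) * 'X^2).
  exact: dvdp_mull.
apply: poly_eq_fun => U; rewrite horner_restrict_line meval_cubicZ -/k -/m.
rewrite hornerM hornerD hornerM hornerD hornerM hornerM !hornerC hornerX hornerXn.
rewrite !mxE !inordK //= -/c -/d -/s /A /C.
apply/eqP; rewrite -subr_eq0; apply/eqP.
transitivity ((1 + U * x) ^+ 2 * U * y * (3 * l ^+ 2 * c - 3 * l ^+ 3 * d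
  + l * k * s)); last by rewrite E mulr0.
by ring.
Qed.

End Sextic.

(** * Irreducibility of the sextic *)

(** Splitting off the powers of [X], the two remaining factors have nonzero constant
    terms, and so their product can be a monomial only if they are constant. *)
Lemma poly_monomial_factor (R : idomainType) (p r : {poly R}) (c : R) d :
  c != 0 -> p * r = c%:P * 'X^d -> exists (a : R) e, p = a%:P * 'X^e.
Proof.
move=> c0 E.
have E0 : c%:P * 'X^d != 0 by rewrite mulf_neq0 ?polyC_eq0 // expf_neq0 ?polyX_eq0.
have p0 : p != 0 by apply: contraNneq E0 => p0; rewrite -E p0 mul0r.
have r0 : r != 0 by apply: contraNneq E0 => r0; rewrite -E r0 mulr0.
have [i [p1]] := multiplicity_XsubC p 0; rewrite p0 subr0 /= => p1n pE.
have [j [r1]] := multiplicity_XsubC r 0; rewrite r0 subr0 /= => r1n rE.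
have pr0 : (p1 * r1)`_0%N != 0.
  by rewrite -horner_coef0 hornerM mulf_neq0.
have {}E : (p1 * r1) * 'X^(i + j) = c%:P * 'X^d.
  by rewrite -E pE rE exprD; ring.
have ijd : (i + j = d)%N.
  have := congr1 (fun u : {poly R} => u`_(i + j)) E.
  rewrite /= [LHS]coefMXn ltnn subnn coefCM coefXn; case: eqP => // _ /eqP.
  by rewrite mulr0 (negPf pr0).
rewrite ijd in E; have {}E : p1 * r1 = c%:P.
  by apply: mulIf E; rewrite expf_neq0 // polyX_eq0.
have : size (p1 * r1) == 1 by rewrite E size_polyC c0.
rewrite size_mul_eq1 => /andP[/eqP sp _].
by exists p1`_0%N, i; rewrite {1}pE {1}(size1_polyC (p := p1)) // sp.
Qed.

Section HomogFactor.
Variables (n : nat) (R : idomainType).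
Implicit Types p r : {mpoly R[n]}.

(** The substitution [X_i := X_i T], which makes the degree visible as the exponent
    of [T]: a polynomial is homogeneous iff its image is a monomial in [T]. *)
Definition grade p : {poly {mpoly R[n]}} :=
  mmap (polyC \o @mpolyC n R) (fun i => ('X_i)%:P * 'X) p.

Lemma coef_grade p e : (grade p)`_e = pihomog mdeg e p.
Proof.
rewrite /grade /mmap coef_sum pihomogE [RHS]big_mkcond /=.
apply: eq_bigr => m _.
have -> : mmap1 (fun i =>
  (('X_i)%:P * 'X : {poly {mpoly R[n]}})) m = ('X_[m])%:P * 'X^(mdeg m).
  rewrite /mmap1 mpolyXE_id rmorph_prod /= mdegE -prodrXr -big_split /=.
  by apply: eq_bigr => i _; rewrite exprMn rmorphXn.
rewrite mulrA -polyCM coefCM coefXn mul_mpolyC eq_sym.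
by case: eqP => _; rewrite ?mulr1 ?mulr0.
Qed.

Lemma homog_factor p r d : p * r != 0 -> p * r \is d.-homog ->
  exists e, p \is e.-homog.
Proof.
move=> pr0 hpr.
have E : grade p * grade r = (p * r)%:P * 'X^d.
  rewrite -[LHS]rmorphM -/(grade (p * r)); apply/polyP => e;
    rewrite coef_grade coefCM coefXn.
  have [->|ed] := eqVneq e d; first by rewrite mulr1 pihomog_dE.
  by rewrite mulr0 (pihomog_ne0 _ hpr) // eq_sym.
have [a [e pE]] := poly_monomial_factor pr0 E.
exists e; rewrite (pihomog_partitionE (mf := mdeg) (leqnn (msize p))).
apply: rpred_sum => i _; have [<-|ie] := eqVneq (i : nat) e; first exact: pihomogP.
by rewrite -coef_grade pE coefCM coefXn (negPf ie) mulr0 rpred0.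
Qed.

Lemma dhomog0_unit p : p != 0 -> (forall c : R, c != 0 -> c \is a GRing.unit) ->
  p \is 0.-homog -> p \is a GRing.unit.
Proof.
move=> p0 U hp.
have pE : p = (p@_0)%:MP.
  apply/mpolyP => m; rewrite mcoeffC; have [<-|m0] := eqVneq 0%MM m;
    first by rewrite mulr1.
  by rewrite mulr0 (dhomog_nemf_coeff hp) // mdeg_eq0 eq_sym.
rewrite pE; apply: rmorph_unit; apply: U; apply: contraNneq p0 => c0.
by rewrite pE c0.
Qed.
End HomogFactor.

Section Cubic.
Variable K : fieldType.
Hypothesis three0 : 3 != 0 :> K.
Variable Q : {poly K}.
Hypothesis Q0 : Q.[0] != 0.

(** The degrees of the two sides differ modulo 3. *)
Lemma cube_times_X (U V : {poly K}) : V != 0 -> U ^+ 3 <> V ^+ 3 * 'X.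
Proof.
move=> V0 E; have := congr1 (fun p : {poly K} => (size p).-1) E.
rewrite size_mulX ?expf_neq0 // size_exp /=.
have := size_exp V 3; rewrite -subn1 => sV.
have V30 : (0 < size (V ^+ 3))%N by rewrite size_poly_gt0 expf_neq0.
case: (size (V ^+ 3)) sV V30 => // m; rewrite subn1 /= => -> _ /(congr1 (modn^~ 3)).
by rewrite /= -[(_ * 3).+1]addn1 -modnDml !modnMl.
Qed.

(** The sextic on the plane [x_2 = 0], in the affine chart [x_3 = 1]; the
    inner variable is [t = x_4] and the outer one [x_1]. *)
Definition plane_sextic : {poly {poly K}} := (Q ^+ 3)%:P - (27 * 'X)%:P * 'X^3.

Lemma size_plane_sextic : size plane_sextic = 4%N.
Proof.
have n27 : 27 != 0 :> {poly K}.
  rewrite (_ : 27 = (3%:P : {poly K}) ^+ 3) ?expf_neq0 ?polyC_eq0 //.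
  by rewrite rmorph_nat; ring.
have s2 : size (- ((27 * 'X)%:P * 'X^3) : {poly {poly K}}) = 4%N.
  rewrite size_polyN mul_polyC size_scale ?size_polyXn //.
  by rewrite mulf_neq0 ?polyX_eq0.
rewrite /plane_sextic addrC size_polyDl s2 //.
by rewrite (leq_ltn_trans (size_polyC_leq1 _)).
Qed.

(** A factor of degree 0 in [x_1] divides both [Q^3] and [27 t], hence is constant as
    [Q(0) <> 0]. A linear factor would give a root of [Q^3 = 27 t x_1^3] in the
    fraction field [K(t)], making [t] a cube there. *)
Lemma plane_sextic_factor (r s : {poly {poly K}}) : r * s = plane_sextic ->
  (size r <= 2)%N -> exists2 k : K, k != 0 & r = k%:P%:P.
Proof.
move=> E sr.
have rs0 : r * s != 0 by rewrite E -size_poly_gt0 size_plane_sextic.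
have [r0 s0] : r != 0 /\ s != 0 by apply/andP; rewrite -negb_or -mulf_eq0.
have C i : (r * s)`_i = plane_sextic`_i by rewrite E.
have n27 : 27 != 0 :> K by rewrite (_ : 27 = 3 ^+ 3) ?expf_neq0 //; ring.
have Q30 : (Q ^+ 3).[0] != 0 by rewrite horner_exp expf_neq0.
have PS0 : plane_sextic`_0%N = Q ^+ 3.
  by rewrite /plane_sextic coefB coefC coefCM coefXn /= mulr0 subr0.
have PS1 i : (0 < i < 3)%N -> plane_sextic`_i = 0.
  case: i => [|[|[|//]]] // _;
    by rewrite /plane_sextic coefB coefC coefCM coefXn /= mulr0 subr0.
have PS3 : plane_sextic`_3%N = - (27 * 'X).
  by rewrite /plane_sextic coefB coefC coefCM coefXn /= mulr1 sub0r.
have [sr1|sr1] := leqP (size r) 1.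
  have rE := size1_polyC sr1; rewrite rE in C; set a := r`_0%N in rE C.
  have C0 := C 0%N; have C3 := C 3%N; rewrite !coefCM PS0 PS3 in C0 C3.
  have a0 : a.[0] != 0.
    by apply: contraNneq Q30; rewrite -C0 hornerM => ->; rewrite mul0r.
  have : root s`_3%N 0.
    have := congr1 (horner^~ 0) C3; rewrite hornerM hornerN hornerM hornerX mulr0 oppr0.
    by move/eqP; rewrite mulf_eq0 (negPf a0).
  case/factor_theorem => u; rewrite subr0 => sE.
  have au : a * u = (- 27)%:P.
    apply: (mulIf (negbT (polyX_eq0 K))); rewrite -mulrA -sE C3.
    by rewrite rmorphN rmorph_nat; ring.
  have : size (a * u) == 1 by rewrite au size_polyC oppr_eq0 n27.
  rewrite size_mul_eq1 => /andP[/eqP sa _].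
  have aE : a = (a`_0%N)%:P by apply: size1_polyC; rewrite sa.
  exists a`_0%N; last by rewrite -aE.
  by apply: contraNneq a0 => h; rewrite aE h horner0.
have {sr sr1} sr2 : size r = 2%N by apply/eqP; rewrite eqn_leq sr.
have ss : size s = 3%N.
  by have := size_mul r0 s0; rewrite E size_plane_sextic sr2 => -[].
pose al := r`_1%N; pose be := r`_0%N.
have rE : r = al%:P * 'X + be%:P.
  apply/polyP => i; rewrite coefD coefMX !coefC.
  case: i => [|[|i]] /=; rewrite ?add0r ?addr0 //.
  by rewrite nth_default // sr2.
have al0 : al != 0 by have := lead_coef_eq0 r;
  rewrite /lead_coef sr2 /= (negPf r0) => /negbT.
have Cf i : (r * s)`_i = al * (if i == 0%N then 0 else s`_i.-1) + be * s`_i.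
  by rewrite rE mulrDl -mulrA [_ * s]mulrC coefD !coefCM coefMX.
have C0 := C 0%N; have C1 := C 1%N; have C2 := C 2%N; have C3 := C 3%N.
rewrite Cf /= PS0 mulr0 add0r in C0; rewrite Cf /= PS1 // in C1.
rewrite Cf /= PS1 // in C2; rewrite Cf /= PS3 in C3.
have s3 : s`_3%N = 0 by rewrite nth_default // ss.
rewrite s3 mulr0 addr0 in C3.
have be0 : be != 0.
  by apply: contraNneq Q30 => be0; rewrite -C0 be0 mul0r horner0.
have E3 : (al * Q) ^+ 3 = (- 3%:P * be) ^+ 3 * 'X.
  rewrite exprMn -C0.
  transitivity (al ^+ 2 * be * (al * s`_0%N + be * s`_1%N) 
    - al * be ^+ 2 * (al * s`_1%N + be * s`_2%N) + be ^+ 3 * (al * s`_2%N)); first by ring.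
  rewrite C1 C2 C3 rmorph_nat; ring.
by case: (cube_times_X _ E3); rewrite mulf_neq0 // oppr_eq0 polyC_eq0.
Qed.

End Cubic.

Section Irreducible.
Variable K : closedFieldType.
Hypothesis (three0 : 3 != 0 :> K).
Variables (q : 'rV[K]_3).
Hypotheses (q00 : q 0 (inord 0) != 0) (q20 : q 0 (inord 2) != 0).

Definition qpoly : {poly K} :=
  form2 (q 0 (inord 0))%:P (q 0 (inord 1))%:P (q 0 (inord 2))%:P 1 'X.

Definition to_plane (p : {mpoly K[4]}) : {poly {poly K}} :=
  mmap (polyC \o @polyC K) (fun i : 'I_4 => nth 0 [:: 'X; 0; 1; 'X%:P] i) p.

Lemma horner_to_plane p x t : (to_plane p).[x%:P].[t] = p.@[(pt x 0 1 t) 0].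
Proof.
rewrite /to_plane /mmap !horner_sum mevalE; apply: eq_bigr => m _ /=.
rewrite hornerM hornerC hornerM hornerC; congr (_ * _).
rewrite /mmap1 !horner_prod; apply: eq_bigr => i _; rewrite !horner_exp; congr (_ ^+ _).
apply: (ord4P (P := fun i => (nth 0 [:: 'X; 0; 1;
  'X%:P] i).[x%:P].[t] = (pt x 0 1 t) 0 i)).
- by rewrite ptE inordK //= hornerX hornerC.
- by rewrite ptE inordK //= !horner0.
- by rewrite ptE inordK //= !hornerC.
- by rewrite ptE inordK //= hornerC hornerX.
Qed.

Lemma to_plane_sextic : to_plane (sextic q) = plane_sextic qpoly.
Proof.
rewrite /to_plane /sextic rmorphB /= rmorphXn /= mmap_form2 mmapZ rmorphM rmorphM /=
  mmap_quarticZ.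
rewrite mmap_form2 mmap_form4 !mmapXU !inordK //= /form2 /form4 !mxE /plane_sextic
  /qpoly /form2.
rewrite !rmorph0 !rmorph_nat; ring.
Qed.

Lemma sextic_0001 : (sextic q).@[(pt 0 0 0 1) 0] != 0.
Proof.
rewrite meval_sextic !ptE /qval /form2 [X in X != 0](_ : _ = q 0 (inord 2) ^+ 3).
  exact: expf_neq0.
by ring.
Qed.

(** A homogeneous factor that is constant on the plane [x_2 = 0], [x_3 = 1] is a
    power of [x_3] on [x_2 = 0]. If its degree were positive it would vanish at
    [(0 : 0 : 0 : 1)], where the sextic does not. *)
Lemma sextic_factor_unit r s k : sextic q = r * s -> k != 0 -> to_plane r = k%:P%:P ->
  r \is a GRing.unit.
Proof.
move=> E k0 rk.
have B0 : sextic q != 0 by apply: contraNneq sextic_0001 => ->; rewrite meval0.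
have r0 : r != 0 by apply: contraNneq B0 => r0; rewrite E r0 mul0r.
have rs0 : r * s != 0 by rewrite -E.
have hB : r * s \is 6.-homog by rewrite -E; exact: dhomog_sextic.
have [e he] := homog_factor rs0 hB.
have [e0|e0] := posnP e.
  by rewrite e0 in he; apply: dhomog0_unit => // c; rewrite unitfE.
have r1 t : r.@[(pt 0 0 1 t) 0] = k by rewrite -horner_to_plane rk !hornerC.
pose u := mmap polyC (fun i : 'I_4 => nth 0 [:: 0; 0; 'X; 1] i) r.
have uE t : u.[t] = r.@[(pt 0 0 t 1) 0].
  rewrite mmap_polyC_horner; apply: meval_eq; apply: ord4P; rewrite ptE inordK //=.
  - exact: horner0.
  - exact: horner0.
  - exact: hornerX.
  - exact: hornerC.
have : u * 'X = k%:P * 'X^e * 'X.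
  apply: poly_eq_fun => t;
    rewrite hornerM [RHS]hornerM hornerM hornerC hornerXn hornerX uE.
  have [->|t0] := eqVneq t 0; first by rewrite !mulr0.
  rewrite (@dhomog_meval _ _ e _ t _ ((pt 0 0 1 t^-1) 0)) // ?r1;
    first by rewrite [k * _]mulrC.
  by apply: ord4P; rewrite !ptE ?mulr0 ?mulr1 // mulfV.
move/(mulIf (negbT (polyX_eq0 K))) => ux.
have := uE 0; rewrite ux hornerM hornerC hornerXn expr0n (gtn_eqF e0) mulr0 => u0.
by have := sextic_0001; rewrite E mevalM -u0 mul0r eqxx.
Qed.

(** On the plane [x_2 = 0] one of two factors has degree at most one in [x_1], hence
    is constant there; being homogeneous, it is constant. *)
Lemma irreducible_sextic : irreducible_elt (sextic q).
Proof.
split.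
- by apply: contraNneq sextic_0001 => ->; rewrite meval0.
- apply/negP => U; have := congr1 (meval ((pt 1 0 0 0) 0)) (mulrV U).
  have -> : meval ((pt 1 0 0 0) 0) (sextic q / sextic q) = 0.
    by rewrite mevalM meval_sextic !ptE /qval /form2; ring.
  by rewrite meval1 => /eqP; rewrite eq_sym oner_eq0.
move=> r s E.
have Q0 : qpoly.[0] != 0.
  rewrite /qpoly /form2 expr1n !mulr1 mul1r hornerD hornerD hornerC hornerM hornerX.
  by rewrite hornerM hornerXn expr0n !mulr0 !addr0.
have E1 : to_plane r * to_plane s = plane_sextic qpoly.
  by rewrite -to_plane_sextic E /to_plane rmorphM.
have rs0 : to_plane r * to_plane s != 0.
  by rewrite E1 -size_poly_gt0 size_plane_sextic.
have [r0 s0] : to_plane r != 0 /\ to_plane s != 0 by apply/andP;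
  rewrite -negb_or -mulf_eq0.
have [sr|sr] := leqP (size (to_plane r)) 2.
  left; have [k k0 rk] := plane_sextic_factor three0 Q0 E1 sr.
  exact: sextic_factor_unit E k0 rk.
right; have ss : (size (to_plane s) <= 2)%N.
  have := size_mul r0 s0; rewrite E1 size_plane_sextic //.
  case: (size (to_plane r)) sr => [|[|[|n]]] // _; rewrite !addSn /=.
  by case: (size _) => [|[|[|m]]] //; rewrite !addnS.
rewrite mulrC in E1; rewrite mulrC in E.
have [k k0 sk] := plane_sextic_factor three0 Q0 E1 ss.
exact: sextic_factor_unit E k0 sk.
Qed.

End Irreducible.

(** * Openness and nonemptiness of the general locus *)

(** Equality of the sizes makes the two Sylvester matrices have the same shape. *)
Lemma resultant_map (aR rR : comNzRingType) (f : {rmorphism aR -> rR}) (p r : {poly aR}) :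
  size (map_poly f p) = size p -> size (map_poly f r) = size r ->
  f (resultant p r) = resultant (map_poly f p) (map_poly f r).
Proof.
move=> sp sr; rewrite /resultant /Sylvester_mx sp sr -det_map_mx /= map_col_mx.
congr (\det (col_mx _ _)); apply: map_lin1_mx => v.
all: by rewrite map_poly_rV rmorphM /= map_rVpoly.
Qed.

Lemma resultant_neq0 (R : idomainType) (p r : {poly R}) :
  p != 0 -> (resultant p r != 0) = coprimep p r.
Proof.
move=> p0; rewrite resultant_eq0 -leqNgt /coprimep.
have : gcdp p r != 0 by rewrite gcdp_eq0 negb_and p0.
by rewrite -size_poly_gt0; case: (size _) => [|[|n]].
Qed.

Lemma size_deriv_unit (R : idomainType) (p : {poly R}) n :
  size p = n.+1 -> n%:R != 0 :> R -> size p^`() = n.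
Proof.
move=> sp n0; have p0 : p != 0 by rewrite -size_poly_gt0 sp.
apply/eqP; rewrite eqn_leq -ltnS -{1}sp lt_size_deriv //=.
case: n n0 sp => [|n n0 sp]; first by rewrite eqxx.
rewrite ltnNge; apply/negP => /leq_sizeP/(_ n (leqnn n)); rewrite coef_deriv => /eqP.
rewrite -mulr_natr mulf_eq0 (negPf n0) orbF => /eqP lc.
by have := lead_coef_eq0 p; rewrite /lead_coef sp /= lc eqxx (negPf p0).
Qed.

Section MapParams.
Variables (A B : idomainType) (f : {rmorphism A -> B}).
Variables q0 q1 q2 g0 g1 g2 g3 g4 : A.

Lemma map_node_poly : map_poly f (node_poly g0 g1 g2 g3 g4)
  = node_poly (f g0) (f g1) (f g2) (f g3) (f g4).
Proof. by rewrite !node_polyE map_Poly. Qed.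

Lemma map_line_poly : map_poly f (line_poly q0 q1 q2 g0 g1 g2 g3 g4)
  = line_poly (f q0) (f q1) (f q2) (f g0) (f g1) (f g2) (f g3) (f g4).
Proof.
rewrite /line_poly map_comp_poly rmorphN /= map_polyXn.
rewrite !triangle_polyE map_Poly /=.
congr ((cons_poly _ (cons_poly _ (cons_poly _ (cons_poly _ (cons_poly _
  (cons_poly _ (cons_poly _ _))))))) \Po _); by ring.
Qed.

End MapParams.

Section Params.
Variable K : closedFieldType.
Hypotheses (two0 : 2 != 0 :> K) (three0 : 3 != 0 :> K).

Let Xq i : {mpoly K[3 + 5]} := 'X_(lshift 5 (inord i : 'I_3)).
Let Xg i : {mpoly K[3 + 5]} := 'X_(rshift 3 (inord i : 'I_5)).

Definition generic_node_poly : {poly {mpoly K[3 + 5]}} :=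
  node_poly (Xg 0) (Xg 1) (Xg 2) (Xg 3) (Xg 4).
Definition generic_line_poly : {poly {mpoly K[3 + 5]}} :=
  line_poly (Xq 0) (Xq 1) (Xq 2) (Xg 0) (Xg 1) (Xg 2) (Xg 3) (Xg 4).

(** The equation of the complement of the general locus, built over the ring of
    polynomials in the eight coefficients. *)
Definition general_poly : {mpoly K[3 + 5]} :=
  Xq 0 * Xq 2 * (Xg 0 * Xg 4) * resultant generic_node_poly generic_node_poly^`() *
    resultant generic_line_poly generic_line_poly^`().

Lemma four_neq0 (A : idomainType) : 2 != 0 :> A -> 4 != 0 :> A.
Proof. by move=> h; rewrite (_ : 4 = 2 ^+ 2) ?expf_neq0 //; ring. Qed.
Lemma eighteen_neq0 (A : idomainType) : 2 != 0 :> A -> 3 != 0 :> A -> 18 != 0 :> A.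
Proof. by move=> h2 h3; rewrite (_ : 18 = 2 * 3 ^+ 2) ?mulf_neq0 ?expf_neq0 //; ring. Qed.

Lemma general_polyP q g :
  (general_poly.@[(row_mx q g) 0] != 0) <-> general q g.
Proof.
have evq i : (Xq i).@[(row_mx q g) 0] = q 0 (inord i) by rewrite mevalXU row_mxEl.
have evg i : (Xg i).@[(row_mx q g) 0] = g 0 (inord i) by rewrite mevalXU row_mxEr.
have mapg : map_poly (meval ((row_mx q g) 0)) generic_node_poly = node_poly_of g.
  by rewrite /generic_node_poly map_node_poly /= !evg.
have mapl : map_poly (meval ((row_mx q g) 0)) generic_line_poly = line_poly_of q g.
  by rewrite /generic_line_poly map_line_poly /= !evg !evq.
have nat0 n : n%:R != 0 :> K -> n%:R != 0 :> {mpoly K[3 + 5]}.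
  by move=> h; rewrite -(rmorph_nat (@mpolyC _ K)) mpolyC_eq0.
have X0 (x : {mpoly K[3 + 5]}) : x.@[(row_mx q g) 0] != 0 -> x != 0.
  by apply: contraNneq => ->; rewrite meval0.
have two0' := nat0 2%N two0; have three0' := nat0 3%N three0.
have resg : g 0 (inord 4) != 0 ->
  ((resultant generic_node_poly generic_node_poly^`()).@[(row_mx q g) 0] != 0) =
    coprimep (node_poly_of g) (node_poly_of g)^`().
  move=> g40; have sg : size (node_poly_of g) = 5%N by apply: size_node_poly.
  have sG : size generic_node_poly = 5%N by apply: size_node_poly; apply: X0; rewrite evg.
  have p0 : node_poly_of g != 0 by rewrite -size_poly_gt0 sg.
  rewrite resultant_map -?deriv_map ?mapg ?resultant_neq0 //.
  - by rewrite sg sG.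
  - by rewrite (size_deriv_unit sg) ?(size_deriv_unit sG) // four_neq0.
have resl : q 0 (inord 2) != 0 ->
  ((resultant generic_line_poly generic_line_poly^`()).@[(row_mx q g) 0] != 0) =
    coprimep (line_poly_of q g) (line_poly_of q g)^`().
  move=> q20; have sg : size (line_poly_of q g) = 19%N by apply: size_line_poly.
  have sG : size generic_line_poly = 19%N by apply: size_line_poly; apply: X0;
    rewrite evq.
  have p0 : line_poly_of q g != 0 by rewrite -size_poly_gt0 sg.
  rewrite resultant_map -?deriv_map ?mapl ?resultant_neq0 //.
  - by rewrite sg sG.
  - by rewrite (size_deriv_unit sg) ?(size_deriv_unit sG) // eighteen_neq0.
rewrite /general_poly !mevalM !evq !evg !mulf_eq0 !negb_or.
split=> [/andP[/andP[/andP[/andP[a b] /andP[c d]] rg] rl]|[[a b c d] rg rl]].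
  by split; rewrite -?resg -?resl.
by rewrite a b c d resg // resl // rg.
Qed.

Lemma coprimep_no_root (p r : {poly K}) : p != 0 ->
  (forall x, p.[x] = 0 -> r.[x] <> 0) -> coprimep p r.
Proof.
move=> p0 h; rewrite /coprimep; apply/negPn/negP => /closed_rootP[x].
by rewrite root_gcd => /andP[/rootP /h n /rootP].
Qed.

(** For [b^2 = 2] take [q = x_3^2 + b x_3 x_4 + x_4^2] and choose [g] so that
    [(q^3 + 27 x_3 x_4 g)(1, t) = 1 + 2 b t^3 + t^6]; then
    [- 9 g(1, t) = (t^2 + 1) (b t^2 + 3 t + b)]. Both are separable in every
    characteristic other than 2 and 3. *)
Lemma general_witness : exists q g, general q g (K := K).
Proof.
have [be] := solve_monicpoly (n := 2%N) (fun i => if i == 0%N then 2 else 0 : K) isT.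
rewrite !big_ord_recl big_ord0 /= expr0 mulr1 mul0r !addr0 => be2.
have nine0 : 9 != 0 :> K by rewrite (_ : 9 = 3 ^+ 2) ?expf_neq0 //; ring.
have be0 : be != 0 by apply: contraNneq two0 => be0; rewrite -be2 be0 expr0n.
pose q : 'rV[K]_3 := \row_i nth 0 [:: 1; be; 1] i.
pose g : 'rV[K]_5 := \row_i nth 0 [:: - be / 9; - 3 / 9; - (2 * be) / 9; - 3 / 9;
  - be / 9] i.
have qE : (q 0 (inord 0) = 1) * (q 0 (inord 1) = be) * (q 0 (inord 2) = 1).
  by rewrite !mxE !inordK.
have gE : (g 0 (inord 0) = - be / 9) * (g 0 (inord 1) = - 3 / 9) *
  (g 0 (inord 2) = - (2 * be) / 9) * (g 0 (inord 3) = - 3 / 9) *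
  (g 0 (inord 4) = - be / 9).
  by rewrite !mxE !inordK.
have nbe : - be / 9 != 0 by rewrite mulf_neq0 ?oppr_eq0 ?invr_eq0.
exists q, g; split; first by rewrite !qE !gE oner_eq0.
- apply: coprimep_no_root; first by rewrite -size_poly_gt0 size_node_poly // gE.
  move=> t; rewrite horner_deriv_node_poly horner_node_poly !gE /form4.
  move=> E0 E1.
  have F0 : (t ^+ 2 + 1) * (be * t ^+ 2 + 3 * t + be) = 0.
    by rewrite -[RHS](mulr0 (- 9)) -[in RHS]E0; field.
  have F1 : 2 * t * (be * t ^+ 2 + 3 * t + be) + (t ^+ 2 + 1) * (2 * be * t + 3) = 0.
    by rewrite -[RHS](mulr0 (- 9)) -[in RHS]E1; field.
  have [t2|t2] := eqVneq (t ^+ 2 + 1) 0.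
    have t2' : t ^+ 2 = - 1 by apply/eqP; rewrite -addr_eq0 t2.
    rewrite t2 mul0r addr0 in F1.
    have : 2 * t * (3 * t) = 0 by rewrite -[RHS]F1; ring: t2'.
    have -> : 2 * t * (3 * t) = - (2 * 3) by ring: t2'.
    by move/eqP; rewrite oppr_eq0 mulf_eq0 (negPf two0) (negPf three0).
  move/eqP: F0; rewrite mulf_eq0 (negPf t2) /= => /eqP w0.
  rewrite w0 mulr0 add0r in F1; move/eqP: F1; rewrite mulf_eq0 (negPf t2) /= => /eqP v0.
  have : 4 * be * (be * t ^+ 2 + 3 * t + be) = (2 * be * t + 3) ^+ 2 - 1 by ring: be2.
  by rewrite w0 v0 mulr0 expr0n sub0r => /esym/eqP; rewrite oppr_eq0 oner_eq0.
- have sl : size (line_poly_of q g) = 19%N by apply: size_line_poly; rewrite qE oner_eq0.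
  apply: coprimep_no_root; first by rewrite -size_poly_gt0 sl.
  move=> l; rewrite horner_deriv_line_poly horner_line_poly horner_deriv_triangle_poly.
  rewrite !qE !gE /form2 /form4; set x := - l ^+ 3.
  have -> : 27 * l ^+ 3 = - (27 * x) by rewrite /x; ring.
  move=> E0 E1.
  have F0 : 1 + 2 * be * x ^+ 3 + x ^+ 6 = 0.
    rewrite -[RHS]E0.
    transitivity ((1 + be * x + x ^+ 2) ^+ 3 - 3 * x * (be + 3 * x + 2 * be * x ^+ 2 +
      3 * x ^+ 3 + be * x ^+ 4)).
      by ring: be2.
    by field.
  have F1 : - 3 * l ^+ 2 * (6 * x ^+ 2 * (be + x ^+ 3)) = 0.
    rewrite -[RHS]E1; congr (_ * _).
    transitivity (3 * (1 + be * x + x ^+ 2) ^+ 2 * (be + 2 * x)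
      - 3 * (be + 3 * x + 2 * be * x ^+ 2 + 3 * x ^+ 3 + be * x ^+ 4)
      - 3 * x * (3 + 4 * be * x + 9 * x ^+ 2 + 4 * be * x ^+ 3)).
      by ring: be2.
    by field.
  have x0 : x != 0.
    by apply/eqP => x0; move/eqP: F0; rewrite x0 !expr0n mulr0 !addr0 oner_eq0.
  have l0 : l != 0 by apply: contraNneq x0 => l0; rewrite /x l0 expr0n oppr0.
  have six0 : 6 != 0 :> K by rewrite (_ : 6 = 2 * 3) ?mulf_neq0 //; ring.
  have n0 : - 3 * l ^+ 2 * (6 * x ^+ 2) != 0 by rewrite !mulf_neq0 ?oppr_eq0 ?expf_neq0.
  move/eqP: F1; rewrite mulrA mulf_eq0 (negPf n0) /= addrC addr_eq0 => /eqP x3.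
  have : 1 + 2 * be * x ^+ 3 + x ^+ 3 ^+ 2 = 0 by rewrite -[RHS]F0; ring.
  rewrite x3; have -> : 1 + 2 * be * - be + (- be) ^+ 2 = - 1 by ring: be2.
  by move/eqP; rewrite oppr_eq0 oner_eq0.
Qed.

End Params.

Theorem proposition7p1 (K : closedFieldType)
    (char2 : 2%N \notin [pchar K]) (char3 : 3%N \notin [pchar K]) :
  exists U : 'rV[K]_(3 + 5) -> Prop,
    [/\ zariski_open U,
        (exists u, U u)
      & forall (q : 'rV[K]_3) (g : 'rV[K]_5), U (row_mx q g) ->
        let f := quarticZ q g in
        (vanishes_on f ell /\ second_kind f ell) /\
        [/\ (* (a) *)
            smooth_surface f /\
            (exists s : seq {vspace 'rV[K]_4},
               [/\ uniq s, size s = 18%N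
                 & forall M, M \in s <->
                     [/\ is_line M, vanishes_on f M, M <> ell & meets M ell]]),
            (* (b) *)
            ~ segre_construction f ell
          & (* (c) *)
            exists (H1 H2 : {vspace 'rV[K]_4}) (B : {mpoly K[4]}),
              [/\ is_plane H1 /\ is_plane H2, H1 <> H2,
                  B \is 6.-homog, irreducible_elt B
                & forall v : 'rV[K]_4, v != 0 ->
                    (S8 f ell v <-> [\/ v \in H1, v \in H2 | B.@[v 0] = 0])]]].
Proof.
have two0 : 2 != 0 :> K by apply: contra char2 => h; rewrite inE.
have three0 : 3 != 0 :> K by apply: contra char3 => h; rewrite inE.
exists (fun v => (general_poly K).@[v 0] != 0); split.
- by exists (eq (general_poly K)) => v; split=> [v0|[p <-]//]; exists (general_poly K).
- have [q [g gen]] := general_witness two0 three0.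
  by exists (row_mx q g); apply/general_polyP.
move=> q g /(general_polyP two0 three0) gen f; split.
  by split; [exact: vanishes_ell|exact: second_kind_ell].
split.
- by split; [exact: smooth_quarticZ|exact: eighteen_lines].
- exact: not_segre.
have [[q0 q2 _ _] _ _] := gen.
exists (coord_plane K 2), (coord_plane K 3), (sextic q); split.
- by split; exact: is_plane_coord.
- exact: coord_planes_neq.
- exact: dhomog_sextic.
- exact: irreducible_sextic.
move=> v _; split; first exact: S8_sextic.
case; [exact: S8_coord_plane2|exact: S8_coord_plane3|exact: S8_of_sextic].
Qed.
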